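(* Let $p$ be a prime and $F$ a power of $p$ with $F>2$. Let $a$ be an integer not divisible by $p$. Then $\omega(a)^{-2}H_p(3,a,F)$ is irrational, i.e. lies in $\mathbb{Q}_p\setminus\mathbb{Q}$.
   Context: Bernoulli numbers: $\frac{t}{e^t-1}=\sum_{n\ge0}B_n\frac{t^n}{n!}$. Teichmüller character $\omega:\mathbb{Z}\to\mathbb{Z}_p$: $\omega(m)=0$ if $p\mid m$; if $p$ is odd and $p\nmid m$, $\omega(m)$ is the unique element of $\mathbb{Z}_p$ with $\omega(m)^{p-1}=1$ and $\omega(m)\equiv m \pmod p$; if $p=2$ and $m$ is odd, $\omega(m)=(-1)^{(m-1)/2}$. For $p\nmid m$ put $\langle m\rangle=\omega(m)^{-1}m$. $p$-adic Hurwitz zeta function: for a positive integer $F$ divisible by $p$, an integer $a$ not divisible by $p$, and $s\in\mathbb{Z}_p$, $s\neq1$, $$H_p(s,a,F)=\frac{1}{F(s-1)}\langle a\rangle^{1-s}\sum_{j=0}^\infty\binom{1-s}{j}B_j\left(\frac Fa\right)^j .$$ *)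

(* Defs.v *)
From HB Require Import structures.
From mathcomp Require Import all_boot all_order all_algebra cyclic.
From mathcomp Require Import all_classical all_reals all_analysis.

Set Implicit Arguments.
Unset Strict Implicit.
Unset Printing Implicit Defensive.

Import Order.TTheory GRing.Theory Num.Theory.

Local Open Scope classical_set_scope.
Local Open Scope ring_scope.

(* Z_p as the inverse limit of the Z/p^n: [residue x n] is the representative of
   x mod p^n in {0, ..., p^n - 1}; the bound is a consequence of the coherence
   condition.  The proof that p is prime is a parameter of the type, so that
   canonical structures can rely on it. *)
Record padic_int (p : nat) (p_pr : prime p) := PadicInt {
  residue : nat -> nat;
  residue_coherent : forall n, residue n = (residue n.+1 %% p ^ n)%N
}.

HB.instance Definition _ p (p_pr : prime p) := gen_eqMixin (padic_int p_pr).
HB.instance Definition _ p (p_pr : prime p) := gen_choiceMixin (padic_int p_pr).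

Section PadicInt.
Context {p : nat} {p_pr : prime p}.
Local Notation Zp := (padic_int p_pr).
Implicit Types x y z : Zp.

Lemma padic_int_ext x y : (forall n, residue x n = residue y n) -> x = y.
Proof.
case: x y => [f cf] [g cg] /= /funext fg; case: _ / fg in cg *.
by congr PadicInt; exact: Prop_irrelevance.
Qed.

Lemma expp_gt0 n : (0 < p ^ n)%N.
Proof. by rewrite expn_gt0 prime_gt0. Qed.

Lemma residue_mod x n : (residue x n %% p ^ n)%N = residue x n.
Proof. by rewrite residue_coherent modn_mod. Qed.

Lemma residue_lt x n : (residue x n < p ^ n)%N.
Proof. by rewrite residue_coherent ltn_mod expp_gt0. Qed.

Lemma residueE x m n : (m <= n)%N -> residue x m = (residue x n %% p ^ m)%N.
Proof.
move=> /subnKC <-; elim: (n - m)%N => [|k IH]; first by rewrite addn0 residue_mod.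
rewrite IH addnS (residue_coherent x (m + k)) modn_dvdm //.
by rewrite dvdn_exp2l // leq_addr.
Qed.

Definition padic_int_of (f : nat -> nat)
  (cf : forall n, f n = f n.+1 %[mod p ^ n]) : Zp.
Proof.
exists (fun n => f n %% p ^ n)%N => n.
by rewrite cf modn_dvdm // dvdn_exp2l.
Defined.

Lemma residueS x n : residue x n = residue x n.+1 %[mod p ^ n].
Proof. by rewrite -residue_coherent residue_mod. Qed.

Fact add_subproof x y n :
  (residue x n + residue y n = residue x n.+1 + residue y n.+1 %[mod p ^ n])%N.
Proof. by rewrite -modnDm residueS (residueS y) modnDm. Qed.

Fact mul_subproof x y n :
  (residue x n * residue y n = residue x n.+1 * residue y n.+1 %[mod p ^ n])%N.
Proof. by rewrite -modnMm residueS (residueS y) modnMm. Qed.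

Fact opp_subproof x n :
  (p ^ n - residue x n = p ^ n.+1 - residue x n.+1 %[mod p ^ n])%N.
Proof.
apply/eqP; rewrite -(eqn_modDr (residue x n)) subnK ?(ltnW (residue_lt _ _)) //.
rewrite -modnDmr residueS modnDmr subnK ?(ltnW (residue_lt _ _)) //.
by rewrite modnn eq_sym expnS modnMl.
Qed.

Definition zp_add x y : Zp := padic_int_of (add_subproof x y).
Definition zp_mul x y : Zp := padic_int_of (mul_subproof x y).
Definition zp_opp x : Zp := padic_int_of (opp_subproof x).
Definition zp_zero : Zp := @padic_int_of (fun=> 0%N) (fun n => erefl).
Definition zp_one : Zp := @padic_int_of (fun=> 1%N) (fun n => erefl).

Fact zp_addA : associative zp_add.
Proof.
by move=> x y z; apply: padic_int_ext => n /=; rewrite modnDml modnDmr addnA.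
Qed.
Fact zp_addC : commutative zp_add.
Proof. by move=> x y; apply: padic_int_ext => n /=; rewrite addnC. Qed.
Fact zp_add0 : left_id zp_zero zp_add.
Proof. by move=> x; apply: padic_int_ext => n /=; rewrite mod0n residue_mod. Qed.
Fact zp_addN : left_inverse zp_zero zp_opp zp_add.
Proof.
move=> x; apply: padic_int_ext => n /=.
by rewrite modnDml subnK ?(ltnW (residue_lt _ _)) // modnn mod0n.
Qed.

HB.instance Definition _ :=
  GRing.isZmodule.Build Zp zp_addA zp_addC zp_add0 zp_addN.

Fact zp_mulA : associative zp_mul.
Proof.
by move=> x y z; apply: padic_int_ext => n /=; rewrite modnMml modnMmr mulnA.
Qed.
Fact zp_mulC : commutative zp_mul.
Proof. by move=> x y; apply: padic_int_ext => n /=; rewrite mulnC. Qed.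
Fact zp_mul1 : left_id zp_one zp_mul.
Proof.
by move=> x; apply: padic_int_ext => n /=; rewrite modnMml mul1n residue_mod.
Qed.
Fact zp_mulDl : left_distributive zp_mul zp_add.
Proof.
by move=> x y z; apply: padic_int_ext => n /=; rewrite modnMml modnDm mulnDl.
Qed.
Fact zp_oner_neq0 : zp_one != 0.
Proof.
apply/eqP => /(congr1 (fun x : Zp => residue x 1)) /=.
by rewrite expn1 modn_small ?prime_gt1 // mod0n.
Qed.

HB.instance Definition _ := GRing.Zmodule_isComNzRing.Build Zp
  zp_mulA zp_mulC zp_mul1 zp_mulDl zp_oner_neq0.

Lemma residue0 n : residue (0 : Zp) n = 0%N. Proof. exact: mod0n. Qed.
Lemma residue1 n : residue (1 : Zp) n = (1 %% p ^ n)%N. Proof. by []. Qed.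
Lemma residueD x y n :
  residue (x + y) n = ((residue x n + residue y n) %% p ^ n)%N.
Proof. by []. Qed.
Lemma residueM x y n :
  residue (x * y) n = ((residue x n * residue y n) %% p ^ n)%N.
Proof. by []. Qed.
Lemma residueN x n : residue (- x) n = ((p ^ n - residue x n) %% p ^ n)%N.
Proof. by []. Qed.
Lemma residueX x k n : residue (x ^+ k) n = (residue x n ^ k %% p ^ n)%N.
Proof.
elim: k => [|k IH]; first by rewrite expr0 residue1.
by rewrite exprS residueM IH modnMmr expnS.
Qed.
Lemma residue_nat k n : residue (k%:R : Zp) n = (k %% p ^ n)%N.
Proof.
elim: k => [|k IH]; first by rewrite residue0 mod0n.
by rewrite -natr1 residueD IH residue1 modnDm addn1.
Qed.

Definition zp_unit : {pred Zp} := fun x => `[< exists y, y * x = 1 >].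
Definition zp_inv x : Zp := xget x [set y | y * x = 1].

Fact zp_mulVr : {in zp_unit, left_inverse 1 zp_inv *%R}.
Proof. by move=> x /asboolP[y yx]; rewrite /zp_inv; case: xgetP => // /(_ y). Qed.
Fact zp_unitP x y : y * x = 1 -> zp_unit x.
Proof. by move=> yx; apply/asboolP; exists y. Qed.
Fact zp_inv_out : {in [predC zp_unit], zp_inv =1 id}.
Proof.
move=> x; rewrite inE => /asboolPn nx; rewrite /zp_inv; case: xgetP => //.
by move=> y _ /= yx; case: nx; exists y.
Qed.

HB.instance Definition _ := GRing.ComNzRing_hasMulInverse.Build Zp
  zp_mulVr zp_unitP zp_inv_out.

Definition zp_val x : nat := xget 0%N [set v | residue x v = 0%N /\ residue x v.+1 <> 0%N].

Lemma residue_eq0W x m n : (m <= n)%N -> residue x n = 0%N -> residue x m = 0%N.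
Proof. by move=> /residueE -> ->; rewrite mod0n. Qed.

Lemma zp_valP x : x != 0 ->
  residue x (zp_val x) = 0%N /\ residue x (zp_val x).+1 <> 0%N.
Proof.
move=> x0; rewrite /zp_val; case: xgetP => [v _ //|novals].
have {}novals v : ~ (residue x v = 0%N /\ residue x v.+1 <> 0%N) by exact: novals.
case/eqP: x0; apply: padic_int_ext; elim=> [|n IH].
  by rewrite residue0; have := residue_lt x 0; case: (residue x 0).
by rewrite residue0; apply: contrapT => nz; apply: (novals n); rewrite IH residue0.
Qed.

Lemma residue_eq0 x n : x != 0 -> (residue x n == 0%N) = (n <= zp_val x)%N.
Proof.
move=> /zp_valP[v0 v1]; apply/eqP/idP => [xn|/residue_eq0W]; last exact.
by rewrite leqNgt; apply/negP => /residue_eq0W /(_ xn).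
Qed.

Lemma logn_residue x n : x != 0 -> (zp_val x < n)%N ->
  (0 < residue x n)%N /\ logn p (residue x n) = zp_val x.
Proof.
move=> x0 vn.
have n0 : (0 < residue x n)%N by rewrite lt0n residue_eq0 // -ltnNge.
split=> //; apply/eqP; rewrite eqn_leq; apply/andP; split.
  rewrite -ltnS ltnNge -pfactor_dvdn //; apply/negP => /eqP.
  by rewrite -residueE //; have [] := zp_valP x0.
rewrite -pfactor_dvdn //; apply/eqP.
by rewrite -residueE ?(ltnW vn) //; have [] := zp_valP x0.
Qed.

Lemma zp_mul_val x y : x != 0 -> y != 0 ->
  x * y != 0 /\ zp_val (x * y) = (zp_val x + zp_val y)%N.
Proof.
move=> x0 y0.
have E n : (zp_val x + zp_val y < n)%N -> [/\ (0 < residue x n * residue y n)%N &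
    logn p (residue x n * residue y n) = (zp_val x + zp_val y)%N].
  move=> vn.
  have [|px lx] := @logn_residue x n x0; first by rewrite (leq_ltn_trans _ vn) ?leq_addr.
  have [|py ly] := @logn_residue y n y0; first by rewrite (leq_ltn_trans _ vn) ?leq_addl.
  by rewrite muln_gt0 px py lognM ?lx ?ly.
have D n m : (zp_val x + zp_val y < n)%N -> (m <= n)%N ->
    (residue (x * y) m == 0%N) = (m <= zp_val x + zp_val y)%N.
  move=> vn mn; rewrite (residueE _ mn) residueM modn_dvdm ?dvdn_exp2l //.
  by have [pos lE] := E n vn; rewrite -/(dvdn _ _) pfactor_dvdn // lE.
have xy0 : x * y != 0.
  apply/eqP => xy; have := D _ _ (ltnSn _) (leqnn _).
  by rewrite xy residue0 ltnn.
split=> //; apply/eqP; rewrite eqn_leq; apply/andP; split.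
  rewrite -(D (zp_val (x * y) + (zp_val x + zp_val y)).+1) ?residue_eq0 //.
    by rewrite ltnS leq_addl.
  by rewrite leqW ?leq_addr.
by rewrite -residue_eq0 // (D (zp_val x + zp_val y).+1).
Qed.

Fact zp_mulf_eq0 x y : x * y = 0 -> (x == 0) || (y == 0).
Proof.
move=> /eqP; apply: contraLR; rewrite negb_or => /andP[x0 y0].
by have [] := zp_mul_val x0 y0.
Qed.

HB.instance Definition _ := GRing.ComUnitRing_isIntegral.Build Zp zp_mulf_eq0.

(* The usual absolute value |x|_p = p^(-v(x)); its values being rational, no
   field of real numbers is needed. *)
Definition zp_norm x : rat := if x == 0 then 0 else p%:R ^- zp_val x.

Lemma expp_rat_gt0 n : 0 < p%:R ^+ n :> rat.
Proof. by rewrite exprn_gt0 // ltr0n prime_gt0. Qed.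

Lemma zp_norm_ge0 x : 0 <= zp_norm x.
Proof. by rewrite /zp_norm; case: ifP => // _; rewrite invr_ge0 ltW ?expp_rat_gt0. Qed.

Lemma zp_norm_eq0 x : (zp_norm x == 0) = (x == 0).
Proof.
rewrite /zp_norm; case: (eqVneq x 0) => [_|x0]; first exact: eqxx.
by rewrite invr_eq0 gt_eqF ?expp_rat_gt0.
Qed.

Lemma zp_norm_le x n : (zp_norm x <= p%:R ^- n) = (residue x n == 0%N).
Proof.
rewrite /zp_norm; case: (eqVneq x 0) => [->|x0].
  by rewrite residue0 eqxx invr_ge0 ltW ?expp_rat_gt0.
rewrite residue_eq0 // lef_pV2 ?posrE ?expp_rat_gt0 //.
by rewrite ler_eXn2l // ltr1n prime_gt1.
Qed.

Lemma zp_normM x y : zp_norm (x * y) = zp_norm x * zp_norm y.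
Proof.
rewrite {2 3}/zp_norm; case: (eqVneq x 0) => [->|x0].
  by rewrite !mul0r /zp_norm eqxx.
case: (eqVneq y 0) => [->|y0]; first by rewrite !mulr0 /zp_norm eqxx.
have [xy0 E] := zp_mul_val x0 y0.
by rewrite /zp_norm (negbTE xy0) E exprD invfM.
Qed.

Lemma zp_norm1 : zp_norm 1 = 1.
Proof.
have n1 : zp_norm 1 != 0 by rewrite zp_norm_eq0 oner_eq0.
by apply: (mulIf n1); rewrite -zp_normM !mul1r.
Qed.

Lemma zp_normN x : zp_norm (- x) = zp_norm x.
Proof.
have /eqP : zp_norm (-1) ^+ 2 = 1 by rewrite expr2 -zp_normM mulrNN mulr1 zp_norm1.
rewrite sqrp_eq1 ?zp_norm_ge0 // => /eqP n1.
by rewrite -mulN1r zp_normM n1 mul1r.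
Qed.

Lemma zp_normD x y : zp_norm (x + y) <= Num.max (zp_norm x) (zp_norm y).
Proof.
wlog xy : x y / zp_norm x <= zp_norm y => [th|].
  by case/orP: (le_total (zp_norm x) (zp_norm y)) => /th //; rewrite addrC maxC.
rewrite (max_idPr xy); case: (eqVneq y 0) => [y0|y0].
  have /eqP : zp_norm x = 0.
    by apply/le_anti; rewrite zp_norm_ge0 andbT (le_trans xy) // y0 /zp_norm eqxx.
  by rewrite zp_norm_eq0 y0 => /eqP ->; rewrite addr0.
have yE : zp_norm y = p%:R ^- zp_val y by rewrite /zp_norm (negbTE y0).
move: xy; rewrite yE zp_norm_le => /eqP xn.
have [yn _] := zp_valP y0.
by rewrite zp_norm_le residueD xn yn mod0n.
Qed.

Definition zp_eqmodp x y := exists z, x - y = p%:R * z.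

Lemma zp_eqmodpP x y : zp_eqmodp x y <-> residue x 1 = residue y 1.
Proof.
split=> [[z] /eqP|xy].
  rewrite subr_eq => /eqP ->; rewrite residueD residueM residue_nat expn1 modnn.
  by rewrite mul0n mod0n add0n -[in RHS]residue_mod expn1.
have xy1 : residue (x - y) 1 = 0%N.
  rewrite residueD residueN xy modnDmr addnC subnK ?modnn //.
  exact: ltnW (residue_lt _ _).
rewrite /zp_eqmodp; move: (x - y) xy1 => d d1.
have dvdp n : (p %| residue d n.+1)%N.
  by apply/eqP; rewrite -{2}(expn1 p) -residueE.
have coh n : (residue d n.+1 %/ p = residue d n.+2 %/ p %[mod p ^ n])%N.
  apply/eqP; rewrite -(eqn_pmul2r (prime_gt0 p_pr)) !muln_modl -!expnSr.
  by rewrite !divnK // residueS.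
exists (padic_int_of coh); apply: padic_int_ext => n.
rewrite residueM residue_nat modnMml /= modnMmr mulnC divnK //.
exact: residue_coherent.
Qed.

Lemma zp_eqmodp_sum (I : Type) (r : seq I) (f g : I -> Zp) :
  (forall i, zp_eqmodp (f i) (g i)) ->
  zp_eqmodp (\sum_(i <- r) f i) (\sum_(i <- r) g i).
Proof.
move=> fg; apply/zp_eqmodpP.
elim/big_ind2: _ => // [x1 x2 y1 y2 ex ey|i _]; last exact/zp_eqmodpP.
by rewrite !residueD ex ey.
Qed.

Lemma zp_eqmodpM x1 x2 y1 y2 :
  zp_eqmodp x1 x2 -> zp_eqmodp y1 y2 -> zp_eqmodp (x1 * y1) (x2 * y2).
Proof.
by move=> /zp_eqmodpP ex /zp_eqmodpP ey; apply/zp_eqmodpP; rewrite !residueM ex ey.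
Qed.

Lemma zp_eqmodpX x y n : zp_eqmodp x y -> zp_eqmodp (x ^+ n) (y ^+ n).
Proof. by move=> /zp_eqmodpP e; apply/zp_eqmodpP; rewrite !residueX e. Qed.

Lemma zp_eqmodp_refl x : zp_eqmodp x x. Proof. exact/zp_eqmodpP. Qed.

Lemma root1_eqmodp_inj x y : x ^+ p.-1 = 1 -> y ^+ p.-1 = 1 ->
  zp_eqmodp x y -> x = y.
Proof.
move=> x1 y1 xy; apply/eqP; rewrite -subr_eq0.
have /eqP : (x - y) * \sum_(i < p.-1) x ^+ (p.-1.-1 - i) * y ^+ i = 0.
  by rewrite -subrXX x1 y1 subrr.
rewrite mulf_eq0 => /orP[//|/eqP S0].
have p2 : (p.-1.-1.+1 = p.-1)%N by rewrite prednK // -subn1 subn_gt0 prime_gt1.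
have : zp_eqmodp 0 (x ^+ p.-1.-1 *+ p.-1).
  rewrite -S0 -[X in _ *+ X]card_ord -sumr_const; apply: zp_eqmodp_sum => i.
  have -> : x ^+ p.-1.-1 = x ^+ (p.-1.-1 - i) * x ^+ i.
    by rewrite -exprD subnK // -ltnS p2.
  apply: zp_eqmodpM; first exact: zp_eqmodp_refl.
  by apply: zp_eqmodpX; apply/zp_eqmodpP; move/zp_eqmodpP: xy.
move=> /(zp_eqmodpM (zp_eqmodp_refl x)) /zp_eqmodpP.
rewrite mulr0 residue0 mulrnAr -exprS p2 x1 residue_nat expn1 modn_small.
  by move=> /eqP; rewrite eq_sym -p2.
by rewrite prednK ?prime_gt0.
Qed.

Lemma int_eqmodp_nat (a : int) : exists b : nat, zp_eqmodp b%:R a%:~R.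
Proof.
exists (residue (a%:~R : Zp) 1); apply/zp_eqmodpP.
by rewrite residue_nat residue_mod.
Qed.

Lemma residue_int_eq0 (a : int) : (residue (a%:~R : Zp) 1 == 0%N) = (p %| a)%Z.
Proof.
have -> : (p %| a)%Z = (p %| `|a|)%N by [].
case: (intP a) => [|n|n].
- by rewrite residue0 eqxx dvdn0.
- by rewrite residue_nat expn1.
rewrite abszN rmorphN residueN residue_nat expn1 /=.
have [/eqP ->|n0] := boolP (p %| n.+1)%N; first by rewrite subn0 modnn.
have r0 : (0 < n.+1 %% p)%N by rewrite lt0n.
rewrite modn_small; last by rewrite ltn_subrL r0 prime_gt0.
by rewrite subn_eq0 leqNgt ltn_mod prime_gt0.
Qed.

Lemma root1_eqmodp_exists (a : int) : ~~ (p %| a)%Z ->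
  exists w, w ^+ p.-1 = 1 /\ zp_eqmodp w a%:~R.
Proof.
rewrite -residue_int_eq0 => a0.
set b := residue (a%:~R : Zp) 1 in a0.
have bp : coprime b p.
  rewrite coprime_sym prime_coprime //; apply: contra a0 => /eqP pb.
  by rewrite -[b]residue_mod expn1 pb.
have bpow n : (b ^ (p ^ n * p.-1) = 1 %[mod p ^ n])%N.
  case: n => [|n]; first by rewrite !modn1.
  have -> : (p ^ n.+1 * p.-1 = totient (p ^ n.+1) * p)%N.
    by rewrite totient_pfactor //= expnS -mulnA mulnC (mulnC (p ^ n)%N).
  by rewrite expnM -modnXm Euler_exp_totient ?coprimeXr // modnXm exp1n.
have coh n : (b ^ (p ^ n) = b ^ (p ^ n.+1) %[mod p ^ n])%N.
  have -> : (p ^ n.+1 = p ^ n + p ^ n * p.-1)%N.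
    by rewrite -mulnS prednK ?prime_gt0 // expnSr.
  by rewrite expnD -modnMmr bpow modnMmr muln1.
exists (padic_int_of coh); split.
  apply: padic_int_ext => n.
  by rewrite residueX /= modnXm -expnM bpow.
by apply/zp_eqmodpP; rewrite /= !expn1 fermat_little // -[RHS]residue_mod expn1.
Qed.

(* For p odd, [teichmullerP] and [teichmuller_uniq] show that the set has exactly
   one element.  The exponent (a - 1) / 2 may be negative, hence the integer power. *)
Definition teichmuller (a : int) : Zp :=
  if (p %| a)%Z then 0
  else if p == 2%N then (-1) ^ ((a - 1) %/ 2)%Z
  else xget 0 [set w | w ^+ (p - 1) = 1 /\ zp_eqmodp w a%:~R].

Lemma teichmullerP (a : int) : p != 2%N -> ~~ (p %| a)%Z ->
  teichmuller a ^+ (p - 1) = 1 /\ zp_eqmodp (teichmuller a) a%:~R.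
Proof.
move=> p2 pa; rewrite /teichmuller (negbTE p2) (negbTE pa).
case: xgetP => [w _ //|now]; have [w] := root1_eqmodp_exists pa.
by rewrite -subn1 => /now.
Qed.

Lemma teichmuller_uniq (a : int) (w : Zp) : p != 2%N -> ~~ (p %| a)%Z ->
  w ^+ (p - 1) = 1 -> zp_eqmodp w a%:~R -> w = teichmuller a.
Proof.
move=> p2 pa w1 /zp_eqmodpP wa; have [t1 /zp_eqmodpP ta] := teichmullerP p2 pa.
apply: root1_eqmodp_inj; rewrite -?subn1 //.
by apply/zp_eqmodpP; rewrite wa ta.
Qed.

End PadicInt.

Notation padic p_pr := {fraction (padic_int p_pr)}.

Notation "x %:F" := (tofrac x) : ring_scope.

Section Padic.
Context {p : nat} {p_pr : prime p}.
Local Notation Zp := (padic_int p_pr).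
Local Notation Qp := (padic p_pr).
Implicit Types u v w : Qp.

Definition padic_norm u : rat := zp_norm (repr u).1 / zp_norm (repr u).2.

Lemma padic_repr u : (repr u).2 != 0 /\ u = (repr u).1%:F / (repr u).2%:F.
Proof.
have d0 : (repr u).2 != 0 by exact: denom_ratioP.
split=> //; apply: canRL (mulfK _) _; first by rewrite tofrac_eq0.
move: d0; have := reprK u; case: (repr u) => -[n d] dn0 <- /= d0.
unlock tofrac; transitivity (\pi_{fraction Zp}%qT
  (FracField.mulf (mkRatio dn0) (Ratio d 1))); first by rewrite FracField.pi_mul.
apply/eqmodP => /=; rewrite FracField.equivfE /FracField.mulf /=
  !numden_Ratio ?mulf_neq0 ?oner_neq0 //.
by rewrite !mulr1 mulrC.
Qed.

Lemma padic_frac u : exists x y : Zp, y != 0 /\ u = x%:F / y%:F.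
Proof. by exists (repr u).1, (repr u).2; exact: padic_repr. Qed.

Lemma padic_normE (x y : Zp) : y != 0 ->
  padic_norm (x%:F / y%:F) = zp_norm x / zp_norm y.
Proof.
move=> y0; rewrite /padic_norm; have [] := padic_repr (x%:F / y%:F).
move: (frac (repr _)) => -[n d] /= d0 /eqP.
rewrite eqr_div ?tofrac_eq0 // -!tofracM tofrac_eq => /eqP xd.
by apply/eqP; rewrite eqr_div ?zp_norm_eq0 // -!zp_normM -xd mulrC.
Qed.

Lemma padic_norm_tofrac (x : Zp) : padic_norm x%:F = zp_norm x.
Proof. by rewrite -[x%:F]divr1 -tofrac1 padic_normE ?oner_neq0 // zp_norm1 divr1. Qed.

Lemma padic_norm_ge0 u : 0 <= padic_norm u.
Proof. by rewrite divr_ge0 ?zp_norm_ge0. Qed.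

Lemma padic_norm_eq0 u : (padic_norm u == 0) = (u == 0).
Proof.
have [x [y [y0 ->]]] := padic_frac u; rewrite padic_normE //.
by rewrite !mulf_eq0 !invr_eq0 !zp_norm_eq0 !tofrac_eq0.
Qed.

Lemma padic_norm0 : padic_norm 0 = 0.
Proof. by apply/eqP; rewrite padic_norm_eq0. Qed.

Lemma padic_normM u v : padic_norm (u * v) = padic_norm u * padic_norm v.
Proof.
have [x [y [y0 ->]]] := padic_frac u; have [x' [y' [y'0 ->]]] := padic_frac v.
rewrite mulf_div -!tofracM !padic_normE ?mulf_neq0 // !zp_normM.
by rewrite mulf_div.
Qed.

Lemma padic_normN u : padic_norm (- u) = padic_norm u.
Proof.
have [x [y [y0 ->]]] := padic_frac u.
by rewrite -mulNr -tofracN !padic_normE // zp_normN.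
Qed.

Lemma padic_normD u v : padic_norm (u + v) <= Num.max (padic_norm u) (padic_norm v).
Proof.
have [x [y [y0 ->]]] := padic_frac u; have [x' [y' [y'0 ->]]] := padic_frac v.
have pos (z : Zp) : z != 0 -> 0 < zp_norm z.
  by move=> z0; rewrite lt_def zp_norm_eq0 z0 zp_norm_ge0.
rewrite addf_div ?tofrac_eq0 // -!tofracM -tofracD !padic_normE ?mulf_neq0 //.
rewrite ler_pdivrMr ?pos ?mulf_neq0 // (le_trans (zp_normD _ _)) //.
rewrite maxr_pMl ?zp_norm_ge0 // !zp_normM.
have -> : zp_norm x / zp_norm y * (zp_norm y * zp_norm y') = zp_norm x * zp_norm y'.
  by rewrite mulrA divfK // gt_eqF ?pos.
have -> // : zp_norm x' / zp_norm y' * (zp_norm y * zp_norm y') = zp_norm x' * zp_norm y.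
by rewrite (mulrC (zp_norm y)) mulrA divfK // gt_eqF ?pos.
Qed.

Definition padic_dist u v : rat := padic_norm (u - v).

Fact padic_distxx u : padic_dist u u = 0.
Proof. by rewrite /padic_dist subrr padic_norm0. Qed.
Fact padic_dist_eq0 u v : padic_dist u v = 0 -> u = v.
Proof. by move/eqP; rewrite padic_norm_eq0 subr_eq0 => /eqP. Qed.
Fact padic_dist_sym u v : padic_dist u v = padic_dist v u.
Proof. by rewrite /padic_dist -padic_normN opprB. Qed.
Fact padic_dist_triangle v u w :
  padic_dist u w <= padic_dist u v + padic_dist v w.
Proof.
rewrite /padic_dist -[u - w](subrKA v) (le_trans (padic_normD _ _)) //.
by rewrite ge_max lerDl lerDr !padic_norm_ge0.
Qed.

HB.instance Definition _ := isPointed.Build Qp 0.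
HB.instance Definition _ := isMetric.Build rat Qp
  padic_distxx padic_dist_eq0 padic_dist_sym padic_dist_triangle.

Definition padic_binom (s : Qp) (j : nat) : Qp :=
  (\prod_(i < j) (s - i%:R)) / j`!%:R.

(* u^s for u in 1 + pZ_p and s in Z_p: the continuous extension of n |-> u^n, see
   [padic_pow_nat]. *)
Definition padic_pow (u s : Qp) : Qp :=
  limn [series padic_binom s k * (u - 1) ^+ k]_k.

Lemma padic_natr_eq0 n : (n%:R == 0 :> Qp) = (n == 0%N).
Proof.
apply/idP/eqP => [|->]; last exact: eqxx.
have -> : (n%:R : Qp) = (n%:R : Zp)%:F by rewrite rmorph_nat.
rewrite tofrac_eq0 => /eqP n0; have := residue_nat n n (p_pr := p_pr).
by rewrite n0 residue0 modn_small // ltn_expl // prime_gt1.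
Qed.

Lemma padic_binom_nat n k : padic_binom n%:R k = 'C(n, k)%:R.
Proof.
rewrite /padic_binom; have -> : \prod_(i < k) (n%:R - i%:R) = (n ^_ k)%:R :> Qp.
  elim: k => [|k IH]; first by rewrite big_ord0.
  rewrite big_ord_recr /= IH ffactnSr natrM.
  have [kn|nk] := leqP k n; first by rewrite natrB.
  by rewrite ffact_small // !mul0r.
rewrite -bin_ffact natrM mulfK // padic_natr_eq0 -lt0n.
exact: fact_gt0.
Qed.

Lemma padic_pow_nat u n : padic_pow u n%:R = u ^+ n.
Proof.
rewrite /padic_pow; apply: lim_near_cst; first exact: metric_hausdorff.
exists n.+1 => // m /= nm.
rewrite /series /= (big_cat_nat (n := n.+1)) //=.
rewrite [X in _ + X = _]big1_seq ?addr0; last first.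
  move=> k; rewrite mem_index_iota => /and3P[_ nk _].
  by rewrite padic_binom_nat bin_small // mul0r.
rewrite big_mkord -[in RHS](subrK 1 u) (addrC (u - 1)) exprDn.
by apply: eq_bigr => k _; rewrite padic_binom_nat expr1n mul1r mulr_natl.
Qed.

End Padic.

(* Formal power series over Q are given by their sequences of coefficients. *)
Definition ps_mul (f g : nat -> rat) (n : nat) : rat :=
  \sum_(i < n.+1) f i * g (n - i)%N.

(* The first n coefficients of 1/f. *)
Fixpoint ps_inv_trunc (f : nat -> rat) (n : nat) : seq rat :=
  if n is m.+1 then
    let s := ps_inv_trunc f m in
    rcons s (((m == 0%N)%:R - \sum_(i < m) s`_i * f (m - i)%N) / f 0%N)
  else [::].

Definition ps_inv (f : nat -> rat) (n : nat) : rat := (ps_inv_trunc f n.+1)`_n.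

Lemma size_ps_inv_trunc f n : size (ps_inv_trunc f n) = n.
Proof. by elim: n => //= n IH; rewrite size_rcons IH. Qed.

Lemma nth_ps_inv_trunc f n i : (i < n)%N -> (ps_inv_trunc f n)`_i = ps_inv f i.
Proof.
elim: n => // n IH; rewrite ltnS leq_eqVlt => /orP[/eqP -> //|lin].
by rewrite /= nth_rcons size_ps_inv_trunc lin IH.
Qed.

Lemma ps_invP f n : f 0%N != 0 -> ps_mul (ps_inv f) f n = (n == 0%N)%:R.
Proof.
move=> f0; rewrite /ps_mul big_ord_recr /= subnn {2}/ps_inv /=.
rewrite nth_rcons size_ps_inv_trunc ltnn eqxx divfK //.
rewrite (eq_bigr (fun i : 'I_n => (ps_inv_trunc f n)`_i * f (n - i)%N)).
  by rewrite addrC subrK.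
by move=> i _; rewrite nth_ps_inv_trunc.
Qed.

(* B_n / n! is the coefficient of t^n in t / (e^t - 1), which is the inverse of
   (e^t - 1) / t = sum_k t^k / (k+1)!. *)
Definition bernoulli (n : nat) : rat :=
  n`!%:R * ps_inv (fun k => (k.+1)`!%:R^-1) n.

Lemma bernoulliP (n : nat) :
  ps_mul (fun k => bernoulli k / k`!%:R)
         (fun k => if k == 0%N then 0 else k`!%:R^-1) n = (n == 1%N)%:R.
Proof.
have factn0 k : k`!%:R != 0 :> rat by rewrite pnatr_eq0 -lt0n fact_gt0.
rewrite /ps_mul big_ord_recr /= subnn eqxx mulr0 addr0.
case: n => [|n]; first by rewrite big_ord0.
rewrite eqSS -(ps_invP n (f := fun k => (k.+1)`!%:R^-1)) ?invr_eq0 ?factn0 //.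
apply: eq_bigr => i _; rewrite /bernoulli (mulrC i`!%:R) mulfK // subSn //.
by rewrite -ltnS.
Qed.

Section Hurwitz.
Context {p : nat} (p_pr : prime p).

Definition teichmuller_angle (a : int) : padic p_pr := (teichmuller a)%:F^-1 * a%:~R.

(* Meaningful for s <> 1, F > 0 divisible by p, and a not divisible by p. *)
Definition padic_hurwitz (s : padic_int p_pr) (a : int) (F : nat) : padic p_pr :=
  (F%:R * (s%:F - 1))^-1 * padic_pow (teichmuller_angle a) (1 - s%:F) *
  limn [series padic_binom (1 - s%:F) j * ratr (bernoulli j) *
               (F%:R / a%:~R) ^+ j]_j.

End Hurwitz.

(* Main.v *)
Require Import Defs.
From mathcomp Require Import all_boot all_order all_algebra.
From mathcomp Require Import all_classical all_reals all_analysis.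
From mathcomp Require Import ring lra zify.

Set Implicit Arguments.
Unset Strict Implicit.
Unset Printing Implicit Defensive.

Import Order.TTheory GRing.Theory Num.Theory.

Local Open Scope ring_scope.

(** Put x = a/F, so that x has p-adic absolute value F > 1.  Since the angle of a
    is 1 modulo p, its power with exponent -2 is the ordinary one, and
    omega(a)^(-2) H_p(3,a,F) is Theta / (2 F^3), where Theta is the p-adic sum of
    sum_j (-1)^j (j+1) B_j x^(-j-2), the asymptotic series of
    2 sum_(m >= 0) 1/(x+m)^3.  It has to be shown that Theta is irrational, and
    this is done with rational approximations P_n / Q_n in the style of Apery.

    Let D_k = prod_(i < k) (x-1-i)(x+i) and X = x(x-1).  The classical expansion
    of (arcsinh)^2 in central differences turns Theta into the inverse factorial
    series sum_j (-1)^j j!^2 / ((j+1) D_(j+1)) ([hurwitz_sum_ifs]), whose partial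
    sums S_K are close to those of the Bernoulli series.  With
      Q_n = sum_k C(n,k) C(n+k,k) D_k / k!^2,
      P_n = sum_k C(n,k) C(n+k,k) D_k / k!^2 S_k,
    both sequences satisfy
      (n+1)^3 y_(n+1) - (2n+1)(n^2+n+1+2X) y_n + n^3 y_(n-1) = 0 for n > 0,
    and so does R_n = sum_(k >= n) of rem_coef n k / D_(k+1), which starts with the
    values of Q_n Theta - P_n and hence equals it.  Everything follows from this.

    - The Casoratian P_(n+1) Q_n - P_n Q_(n+1) is 2/(n+1)^3, so a rational
      Theta = q cannot have Q_n q = P_n for two consecutive n ([casoratian]).
    - The recurrence has the double characteristic root 1: Q_n and P_n grow only
      polynomially as real numbers ([apery_op_growth]).
    - With d_n = lcm(1,...,n), the integer d_n^3 (F^n p^(v(n!)))^2 clears the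
      denominators of Q_n and P_n ([apery_den_int], [apery_num_int]); apart from
      d_n^3 it is a power of p, so that it gains p-adically what it costs in size.
    - Every term of R_n has absolute value at most (2k+1) |k!|^2 F^(-2k), and
      |k!|^2 F^(-2k) is O(25^(-k)) as soon as F > 2 ([pnorm_fact_geom]); this is
      tightest for p = F = 3, where the true rate is 27.

    Were Theta rational, a nonzero integer would have the product of its two
    absolute values at least 1 and at most d_n^3 25^(-n) up to subexponential
    factors ([lower_bound]).  But d_n <= (29/10)^n for infinitely many n
    ([lcm_upto_small]) and (29/10)^3 < 25: contradiction. *)

(** * Alternating binomial sums and Bernoulli numbers *)

Definition altsum (m : nat) (f : nat -> rat) : rat :=
  \sum_(i < m.+1) (-1) ^+ i * 'C(m, i)%:R * f i.

Lemma eq_altsum m (g f : nat -> rat) :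
  (forall i, f i = g i) -> altsum m f = altsum m g.
Proof. by move=> fg; apply: eq_bigr => i _; rewrite fg. Qed.

Arguments eq_altsum [m] g [f].

Lemma altsumZ m c (f : nat -> rat) :
  altsum m (fun i => c * f i) = c * altsum m f.
Proof. by rewrite mulr_sumr; apply: eq_bigr => i _; rewrite mulrCA. Qed.

Lemma altsumB m (f g : nat -> rat) :
  altsum m (fun i => f i - g i) = altsum m f - altsum m g.
Proof. by rewrite -sumrB; apply: eq_bigr => i _; rewrite mulrBr. Qed.

Lemma altsum_sum m n (f : nat -> nat -> rat) :
  altsum m (fun i => \sum_(j < n) f j i) = \sum_(j < n) altsum m (f j).
Proof.
by rewrite exchange_big; apply: eq_bigr => i _; rewrite mulr_sumr.
Qed.

Lemma altsumS m (f : nat -> rat) :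
  altsum m.+1 f = altsum m f - altsum m (fun i => f i.+1).
Proof.
rewrite /altsum big_ord_recl [in X in X - _]big_ord_recl /= !bin0 -addrA; congr (_ + _).
rewrite big_ord_recr /= binn [in X in _ - X]big_ord_recr /= binn opprD addrA -sumrB.
rewrite /bump /= !add1n exprS !mulN1r !mulNr; congr (_ - _).
by apply: eq_bigr => i _; rewrite /bump /= add1n binS natrD exprS; ring.
Qed.

Lemma altsum1 m : altsum m.+1 (fun=> 1) = 0.
Proof. by rewrite altsumS subrr. Qed.

(** The partial fraction expansion of 1 / (y (y+1) ... (y+m)), obtained by taking the
    m-th difference of 1/y.  It serves three times: to sum the Bernoulli series, to
    bound denominators by lcm(1,...,n), and to bound p-adic sizes. *)
Lemma altsum_partial_fraction m (y : rat) : (forall i, (i <= m)%N -> y + i%:R != 0) ->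
  altsum m (fun i => (y + i%:R)^-1) = m`!%:R / \prod_(i < m.+1) (y + i%:R).
Proof.
elim: m y => [|m IH] y y0.
  by rewrite /altsum !big_ord1 bin0 expr0 !mul1r.
rewrite altsumS IH; last by move=> i im; apply: y0; rewrite leqW.
rewrite (eq_altsum (fun i => (y + 1 + i%:R)^-1)); last first.
  by move=> i; rewrite -[i.+1%:R]natr1; congr (_^-1); ring.
rewrite IH; last first.
  by move=> i im; move: (y0 i.+1 im); rewrite -addn1 natrD (addrC i%:R) addrA.
have y00 : y != 0 by move: (y0 0%N isT); rewrite addr0.
have y01 : y + m.+1%:R != 0 by exact: y0.
pose B : rat := \prod_(i < m) (y + 1 + i%:R).
have B0 : B != 0.
  apply/prodf_neq0 => i _; move: (y0 i.+1); rewrite -addn1 natrD (addrC i%:R) addrA.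
  by apply; rewrite addn1 (leq_trans (ltn_ord i)).
have E1 : \prod_(i < m.+1) (y + i%:R) = y * B.
  rewrite big_ord_recl /= addr0; congr (_ * _); apply: eq_bigr => i _.
  by rewrite /bump /= natrD addrA.
have E2 : \prod_(i < m.+1) (y + 1 + i%:R) = B * (y + m.+1%:R).
  by rewrite big_ord_recr /= -/B; congr (_ * _); rewrite -natr1; ring.
have E3 : \prod_(i < m.+2) (y + i%:R) = y * B * (y + m.+1%:R).
  by rewrite big_ord_recr /= E1.
rewrite E1 E2 E3 factS natrM; field.
by rewrite nat1r y01 B0 y00.
Qed.

Lemma altsum_weighted m (f : nat -> rat) :
  altsum m.+2 (fun i => i%:R * (m.+2%:R - i%:R) * f i)
  = - (m.+2%:R * m.+1%:R) * altsum m (fun i => f i.+1).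
Proof.
rewrite /altsum big_ord_recl /= mul0r mul0r mulr0 add0r big_ord_recr /=.
rewrite /bump /= !add1n subrr mulr0 mul0r mulr0 addr0 mulr_sumr.
apply: eq_bigr => i _; rewrite /bump /= add1n.
have H : (i.+1%:R * (m.+2%:R - i.+1%:R) * 'C(m.+2, i.+1)%:R
          = m.+2%:R * m.+1%:R * 'C(m, i)%:R :> rat).
  have im : (i.+1 <= m.+2)%N by rewrite ltnS ltnW.
  have E : (i.+1 * (m.+2 - i.+1) * 'C(m.+2, i.+1) = m.+2 * m.+1 * 'C(m, i))%N.
    by rewrite mulnAC -mul_bin_diag /= -mulnA subSS [X in (_ * X)%N]mulnC -mul_bin_down /= mulnA.
  by rewrite -(natrB _ im) -!natrM E.
by rewrite exprS; transitivity (- (-1) ^+ i * (i.+1%:R * (m.+2%:R - i.+1%:R) *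
  'C(m.+2, i.+1)%:R) * f i.+1); [ring | rewrite H; ring].
Qed.

(** The central factorial numbers: the 2k-th central difference of t^m at 0, divided
    by (2k)!, which is also the coefficient of t^2 (t^2 - 1) ... (t^2 - (k-1)^2) in
    the expansion of t^m for even m. *)
Definition central_factorial (k m : nat) : rat :=
  altsum k.*2 (fun i => (i%:R - k%:R) ^+ m) / (k.*2)`!%:R.

Lemma fact_neq0 n : n`!%:R != 0 :> rat.
Proof. by rewrite pnatr_eq0 -lt0n fact_gt0. Qed.

(** Multiplying t^m by t^2 = k^2 + (t^2 - k^2): the second summand cancels the two
    extreme nodes of the difference. *)
Lemma central_factorial_rec k m : central_factorial k.+1 m.+2 =
  k.+1%:R ^+ 2 * central_factorial k.+1 m + central_factorial k m.
Proof.
rewrite /central_factorial doubleS.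
rewrite (eq_altsum (fun i => k.+1%:R ^+ 2 * (i%:R - k.+1%:R) ^+ m
   - i%:R * ((k.*2.+2)%:R - i%:R) * (i%:R - k.+1%:R) ^+ m)); last first.
  (* (i-k-1)^2 = (k+1)^2 - i (2k+2-i) *)
  move=> i; rewrite !exprS -doubleS -mul2n natrM; ring.
rewrite altsumB altsumZ altsum_weighted.
have -> : altsum k.*2 (fun i => (i.+1%:R - k.+1%:R) ^+ m) =
          altsum k.*2 (fun i => (i%:R - k%:R) ^+ m).
  by apply: eq_altsum => i; rewrite -!natr1; congr (_ ^+ _); ring.
rewrite !factS !natrM; field.
by rewrite fact_neq0 nat1r -natrD !pnatr_eq0.
Qed.

Lemma central_factorial0 m : central_factorial 0 m = (m == 0%N)%:R.
Proof. by rewrite /central_factorial /altsum big_ord1 subr0 expr0n bin0 !mul1r divr1. Qed.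

Lemma central_factorial_eq0 k m : (m < k.*2)%N -> central_factorial k m = 0.
Proof.
elim/ltn_ind: m k => m IH [|k] //.
case: m IH => [|[|m]] IH.
- by move=> _; rewrite /central_factorial (eq_altsum (fun=> 1)) ?altsum1 ?mul0r // => i;
  rewrite expr0.
- move=> _; rewrite /central_factorial doubleS altsumS -altsumB (eq_altsum (fun=> -1 * 1)).
    by rewrite altsumZ altsum1 mulr0 mul0r.
  by move=> i; rewrite !expr1 -!natr1; ring.
move=> mk; rewrite central_factorial_rec !IH ?mulr0 ?addr0 //; lia.
Qed.

(** The formula D^2 = 2 sum_k (-1)^k k!^2 delta^(2k+2) / (2k+2)! for the second
    derivative at 0 in terms of central differences, tested on monomials: this is the
    Taylor series of 4 (arcsinh (delta/2))^2.  By the recurrence the sum telescopes. *)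
Lemma sum_central_factorial K m : (m < K.*2)%N ->
  \sum_(k < K) (-1) ^+ k * k`!%:R ^+ 2 * central_factorial k.+1 m.+2 = (m == 0%N)%:R.
Proof.
move=> mK.
have tele : forall L, \sum_(k < L) (-1) ^+ k * k`!%:R ^+ 2 * central_factorial k.+1 m.+2
   = central_factorial 0 m - (-1) ^+ L * L`!%:R ^+ 2 * central_factorial L m.
  elim=> [|L IH]; first by rewrite big_ord0 expr0 fact0 expr1n !mul1r subrr.
  rewrite big_ord_recr /= IH central_factorial_rec factS natrM [(-1) ^+ L.+1]exprS; ring.
by rewrite tele (central_factorial_eq0 mK) mulr0 subr0 central_factorial0.
Qed.

(** The coefficient of delta^(2k+2) in 4 (arcsinh (delta/2))^2. *)
Definition diff_weight (k : nat) : rat :=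
  (-1) ^+ k * k`!%:R ^+ 2 / (k.+1%:R * (k.*2.+1)`!%:R).

(** A difference formula for (-1)^j (j+1) B_j, see [bernoulli_diffE]. *)
Definition bernoulli_diff (K j : nat) : rat :=
  \sum_(k < K) diff_weight k *
     - altsum k.*2.+1 (fun i => (i%:R - k%:R) ^+ j.+1).

Lemma sum_binomial_alternating (t : rat) n :
  \sum_(i < n) 'C(n.+1, i.+1)%:R * (-1) ^+ i * t ^+ i.+1
  = 1 + (- t) ^+ n.+1 - (1 - t) ^+ n.+1.
Proof.
have := exprDn 1 (- t) n.+1; rewrite big_ord_recl big_ord_recr /= => ->.
rewrite bin0 binn !expr1n expr0 !mul1r !mulr1n /bump /= !add1n.
rewrite (_ : \sum_(i < n) _ = - \sum_(i < n) (1 ^+ (n.+1 - bump 0 i) * (- t) ^+ bump 0 i)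
  *+ 'C(n.+1, bump 0 i)).
  rewrite /bump /=; ring.
rewrite -sumrN; apply: eq_bigr => i _.
rewrite /bump /= add1n expr1n mul1r -mulr_natl (exprNn t) !exprS; ring.
Qed.

(** The recurrence that characterizes the numbers (-1)^j (j+1) B_j.  By
    [sum_binomial_alternating] the left side applies the difference operator to
    h(t+1) - h(t) with h(t) = (1-t)^(n+1), which raises the order of every difference
    by one and makes [sum_central_factorial] applicable. *)
Lemma bernoulli_diff_rec K n : (0 < n <= K.*2)%N ->
  \sum_(i < n) 'C(n.+1, i.+1)%:R * (-1) ^+ i * bernoulli_diff K i = 2 *+ (n == 1%N).
Proof.
case: n => // n /= nK.
rewrite /bernoulli_diff /diff_weight.
under eq_bigr => i _ do rewrite mulr_sumr.
rewrite exchange_big /=.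
transitivity (2 * (-1) ^+ n * \sum_(k < K) (-1) ^+ k * k`!%:R ^+ 2 * central_factorial k.+1 n.+2).
  rewrite mulr_sumr; apply: eq_bigr => k _.
  rewrite (eq_bigr (fun i : 'I_n.+1 => (-1) ^+ k * k`!%:R ^+ 2 / (k.+1%:R * (k.*2.+1)`!%:R) *
     - altsum k.*2.+1 (fun l => 'C(n.+2, i.+1)%:R * (-1) ^+ i * (l%:R - k%:R) ^+ i.+1)));
       last first.
    by move=> i _; rewrite altsumZ; ring.
  rewrite -mulr_sumr sumrN.
  rewrite -(altsum_sum _ _ (fun i l => 'C(n.+2, i.+1)%:R * (-1) ^+ i * (l%:R - k%:R) ^+ i.+1)).
  rewrite (eq_altsum (fun l => 1 - ((-1) ^+ n * (l%:R - k.+1%:R) ^+ n.+2 - 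
      (-1) ^+ n * (l.+1%:R - k.+1%:R) ^+ n.+2))); last first.
    move=> l; rewrite sum_binomial_alternating.
    have -> : 1 - (l%:R - k%:R) = - (l%:R - k.+1%:R) :> rat by rewrite -natr1; ring.
    have -> : l.+1%:R - k.+1%:R = l%:R - k%:R :> rat by rewrite -!natr1; ring.
    have sgn (y : rat) : (- y) ^+ n.+2 = (-1) ^+ n * y ^+ n.+2.
      by rewrite [LHS]exprNn -[(-1) ^+ n.+2]signr_odd /= negbK signr_odd.
    rewrite !sgn; move: (_ ^+ n.+2) (_ ^+ n.+2) ((-1) ^+ n) => u v w; ring.
  rewrite altsumB altsum1 altsumB -altsumS altsumZ /central_factorial doubleS !factS !natrM.
  have -> : k.*2.+2%:R = 2 * k.+1%:R :> rat by rewrite -doubleS -mul2n natrM.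
  field.
  by rewrite fact_neq0 !nat1r !pnatr_eq0.
rewrite sum_central_factorial; last exact: nK.
by case: n nK => [|n] _; rewrite ?mulr0 // expr0 !mulr1.
Qed.

(** * An Apery-like recurrence and its three solutions *)

(** The product of the X - i(i+1) for i < k, where X = y(y-1).  The shift by one makes
    [dbinom k] at n+1 equal to C(n,k) C(n+k,k). *)
Definition node_prod (k : nat) (y : rat) : rat := \prod_(i < k) ((y - 1 - i%:R) * (y + i%:R)).

Lemma node_prod0 y : node_prod 0 y = 1. Proof. by rewrite /node_prod big_ord0. Qed.

Lemma node_prodS k y : node_prod k.+1 y = node_prod k y * ((y - 1 - k%:R) * (y + k%:R)).
Proof. by rewrite /node_prod big_ord_recr. Qed.

Lemma node_prod_up k y : node_prod k.+1 (y + 1) = (y + k.+1%:R) * (y + k%:R) * node_prod k y.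
Proof.
elim: k => [|k IH]; first by rewrite node_prodS !node_prod0; ring.
by rewrite node_prodS IH node_prodS -!natr1; ring.
Qed.

Lemma node_prod_down k y : node_prod k.+1 (y - 1) = (y - k.+2%:R) * (y - k.+1%:R) * node_prod k y.
Proof.
elim: k => [|k IH]; first by rewrite node_prodS !node_prod0; ring.
by rewrite node_prodS IH node_prodS -!natr1; ring.
Qed.

Definition dbinom (k : nat) (y : rat) : rat := node_prod k y / k`!%:R ^+ 2.

Lemma dbinom0 y : dbinom 0 y = 1.
Proof. by rewrite /dbinom node_prod0 expr1n divr1. Qed.

Lemma dbinomS k y : k.+1%:R ^+ 2 * dbinom k.+1 y = (y - 1 - k%:R) * (y + k%:R) * dbinom k y.
Proof.
rewrite /dbinom node_prodS factS natrM; field.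
by rewrite fact_neq0 nat1r pnatr_eq0.
Qed.

(** Duality of the two arguments of sum_k C(n,k) C(n+k,k) D_k(x) / k!^2: this relation
    in y = n+1 says that the coefficients transform the multiplication by X in the
    basis D_k / k!^2 into the Apery-like operator in n. *)
Lemma dbinom_rec k y :
  y ^+ 3 * dbinom k.+1 (y + 1) + (y - 1) ^+ 3 * dbinom k.+1 (y - 1)
  - (2 * y - 1) * (y ^+ 2 - y + 1 + 2 * (k.+1%:R * k.+2%:R)) * dbinom k.+1 y
  = 2 * (2 * y - 1) * k.+1%:R ^+ 2 * dbinom k y.
Proof.
rewrite /dbinom node_prod_up node_prod_down node_prodS factS natrM -!natr1; field.
by rewrite fact_neq0 ?natr1 ?nat1r pnatr_eq0.
Qed.

Lemma dbinom_nat_eq0 n k : (n < k)%N -> dbinom k n.+1%:R = 0.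
Proof.
move=> nk; rewrite /dbinom /node_prod (bigD1 (Ordinal nk)) //= -natr1.
by rewrite addrK subrr !mul0r.
Qed.

(** Terms and partial sums of the inverse factorial series of Theta. *)
Definition ifs_term (x : rat) (j : nat) : rat :=
  (-1) ^+ j * j`!%:R ^+ 2 / (j.+1%:R * node_prod j.+1 x).
Definition ifs_sum (x : rat) (K : nat) : rat := \sum_(j < K) ifs_term x j.

Definition dbinom_comb (V : nat -> rat) (n : nat) (x : rat) : rat :=
  \sum_(k < n.+1) dbinom k n.+1%:R * dbinom k x * V k.

Lemma dbinom_comb_widen V n x N : (n < N)%N ->
  dbinom_comb V n x = \sum_(k < N) dbinom k n.+1%:R * dbinom k x * V k.
Proof.
move=> /subnKC <-; rewrite big_split_ord /= -[LHS]addr0; congr (_ + _).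
by rewrite big1 // => i _; rewrite dbinom_nat_eq0 ?mul0r //= addSn ltnS leq_addr.
Qed.

(** At n = 0 the last summand vanishes whatever [u n.-1] is, so that a single formula
    covers the initial step, where it carries the inhomogeneous term. *)
Definition apery_op (x : rat) (u : nat -> rat) (n : nat) : rat :=
  n.+1%:R ^+ 3 * u n.+1
  - n.*2.+1%:R * (n%:R ^+ 2 + n%:R + 1 + 2 * (x * (x - 1))) * u n
  + n%:R ^+ 3 * u n.-1.

(** For constant V the relation [dbinom_rec] cancels all coefficients; in general
    there remains one term for each increment of V. *)
Lemma apery_op_dbinom_comb V x n :
  apery_op x (fun m => dbinom_comb V m x) n =
  2 * n.*2.+1%:R * \sum_(k < n.+1) k.+1%:R ^+ 2 * dbinom k n.+1%:R * dbinom k.+1 x * (V k.+1 - V k).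
Proof.
have rec k : n.+1%:R ^+ 3 * dbinom k n.+2%:R + n%:R ^+ 3 * dbinom k n.-1.+1%:R
   - n.*2.+1%:R * (n%:R ^+ 2 + n%:R + 1 + 2 * (k%:R * k.+1%:R)) * dbinom k n.+1%:R
   = if k is k'.+1 then 2 * n.*2.+1%:R * k%:R ^+ 2 * dbinom k' n.+1%:R else 0.
  case: k => [|k].
    by rewrite !dbinom0 -mul2n -!natr1 natrM; ring.
  have := dbinom_rec k n.+1%:R.
  have -> : n.+1%:R + 1 = n.+2%:R :> rat by rewrite natr1.
  have -> : 2 * n.+1%:R - 1 = n.*2.+1%:R :> rat by rewrite -mul2n -!natr1 natrM; ring.
  have -> : n.+1%:R - 1 = n%:R :> rat by rewrite -natr1 addrK.
  have -> : n.+1%:R ^+ 2 - n.+1%:R + 1 = n%:R ^+ 2 + n%:R + 1 :> rat by rewrite -natr1; ring.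
  move=> <-; case: (n) => [|m] /=; last by ring.
  by rewrite expr0n /=; ring.
(* all three sums are extended by zero terms to the same range *)
rewrite /apery_op !(@dbinom_comb_widen _ _ _ n.+2) //; last by case: (n) => // m /=; lia.
pose b k := if k is k'.+1 then 2 * n.*2.+1%:R * k%:R ^+ 2 * dbinom k' n.+1%:R else 0.
transitivity (\sum_(k < n.+2) b k * dbinom k x * V k
   - 2 * n.*2.+1%:R * \sum_(k < n.+2) k.+1%:R ^+ 2 * dbinom k n.+1%:R * dbinom k.+1 x * V k).
  rewrite !mulr_sumr -!sumrB -big_split /=; apply: eq_bigr => k _.
  have nb := dbinomS k x.
  have -> : k.+1%:R ^+ 2 * dbinom k n.+1%:R * dbinom k.+1 x * V k =
    (k.+1%:R ^+ 2 * dbinom k.+1 x) * dbinom k n.+1%:R * V k by ring.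
  by rewrite nb /b -rec -!natr1; ring.
rewrite big_ord_recl [in X in _ - X]big_ord_recr /= dbinom_nat_eq0 // mulr0 !mul0r add0r addr0.
rewrite !mulr_sumr -sumrB; apply: eq_bigr => k _.
by rewrite /bump /= add1n; ring.
Qed.

Definition apery_den (x : rat) (n : nat) : rat := dbinom_comb (fun=> 1) n x.
Definition apery_num (x : rat) (n : nat) : rat := dbinom_comb (ifs_sum x) n x.

Lemma apery_op_den x n : apery_op x (apery_den x) n = 0.
Proof. by rewrite apery_op_dbinom_comb big1 ?mulr0 // => i _; rewrite subrr mulr0. Qed.

(** The integral over [0,1] of a shifted Legendre polynomial; the partial sums have a
    closed form. *)
Lemma sum_legendre n :
  \sum_(k < n.+1) (-1) ^+ k * dbinom k n.+1%:R / k.+1%:R = (n == 0%N)%:R.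
Proof.
case: n => [|n]; first by rewrite big_ord1 /= dbinom0 expr0 !mul1r.
have n0 : n.+1%:R * n.+2%:R != 0 :> rat by rewrite mulf_neq0 ?pnatr_eq0.
(* the closed form, which vanishes at m = n+2 because the coefficient does *)
have tele m : \sum_(k < m) (-1) ^+ k * dbinom k n.+2%:R / k.+1%:R
    = - (-1) ^+ m * (m%:R * dbinom m n.+2%:R) / (n.+1%:R * n.+2%:R).
  elim: m => [|m IH]; first by rewrite big_ord0 ?(mul0r, mulr0).
  rewrite big_ord_recr /= IH.
  have m0 : m.+1%:R != 0 :> rat by rewrite pnatr_eq0.
  have -> : m.+1%:R * dbinom m.+1 n.+2%:R = (m.+1%:R ^+ 2 * dbinom m.+1 n.+2%:R) / m.+1%:R.
    by field; rewrite nat1r.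
  rewrite dbinomS exprS -!natr1; field.
  by rewrite !natr1 !pnatr_eq0.
by rewrite tele dbinom_nat_eq0 // !mulr0 mul0r.
Qed.

Section NonVanishing.
Variable x : rat.
Hypothesis x0 : forall k, node_prod k x != 0.

(** The increments of [ifs_sum] reduce the remaining terms to [sum_legendre]. *)
Lemma apery_op_num n : apery_op x (apery_num x) n = 2 * (n == 0%N)%:R.
Proof.
rewrite apery_op_dbinom_comb.
rewrite (eq_bigr (fun k : 'I_n.+1 => (-1) ^+ k * dbinom k n.+1%:R / k.+1%:R)).
  by rewrite sum_legendre; case: n => [|n]; rewrite ?mulr0 // !mulr1.
move=> k _; rewrite /ifs_sum big_ord_recr /= [in _ - _]addrC addrK /ifs_term {2}/dbinom.
rewrite factS natrM; field.
by rewrite fact_neq0 nat1r pnatr_eq0 x0.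
Qed.

Lemma casoratian n :
  apery_num x n.+1 * apery_den x n - apery_num x n * apery_den x n.+1 = 2 / n.+1%:R ^+ 3.
Proof.
have n0 m : m.+1%:R != 0 :> rat by rewrite pnatr_eq0.
apply: (mulfI (expf_neq0 3 (n0 n))); rewrite [RHS]mulrC divfK ?expf_neq0 //.
elim: n => [|n IH].
  have := apery_op_den x 0; have := apery_op_num 0; rewrite /apery_op /= !expr0n /= => hP hQ.
  have Q0 : apery_den x 0 = 1 by rewrite /apery_den /dbinom_comb big_ord1 !dbinom0 !mulr1.
  have P0 : apery_num x 0 = 0 by rewrite /apery_num /dbinom_comb big_ord1 /ifs_sum big_ord0 mulr0.
  by move: hP hQ; rewrite Q0 P0 => hP hQ; lra.
have := apery_op_den x n.+1; have := apery_op_num n.+1; rewrite /apery_op /= !mulr0.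
set c := n.*2.+3%:R * _ => hP hQ.
have eP : n.+2%:R ^+ 3 * apery_num x n.+2 = c * apery_num x n.+1 - n.+1%:R ^+ 3 * apery_num x n.
  by rewrite -[LHS]subr0 -hP; ring.
have eQ : n.+2%:R ^+ 3 * apery_den x n.+2 = c * apery_den x n.+1 - n.+1%:R ^+ 3 * apery_den x n.
  by rewrite -[LHS]subr0 -hQ; ring.
rewrite mulrBr mulrA eP mulrCA eQ -IH; ring.
Qed.

(** This is k!^2 / ((k-n)! (k+n+1)!) for n <= k, and 0 otherwise.  The product form
    keeps the recurrences valid across the boundary. *)
Definition rem_ratio (n k : nat) : rat :=
  \prod_(i < n) (k%:R - i%:R) / \prod_(i < n.+1) (k.+1%:R + i%:R).

Lemma natD_neq0 (a b : nat) : a.+1%:R + b%:R != 0 :> rat.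
Proof. by rewrite -natrD pnatr_eq0. Qed.

Lemma rem_ratio0 k : rem_ratio 0 k = k.+1%:R^-1.
Proof. by rewrite /rem_ratio big_ord0 big_ord1 addr0 mul1r. Qed.

Lemma rem_ratioS n k : rem_ratio n.+1 k = rem_ratio n k * (k%:R - n%:R) / (k%:R + n.+2%:R).
Proof.
rewrite /rem_ratio big_ord_recr [X in _ / X]big_ord_recr /=.
have -> : k.+1%:R + n.+1%:R = k%:R + n.+2%:R :> rat by rewrite -!natr1; ring.
have D0 : \prod_(i < n.+1) (k.+1%:R + i%:R) != 0 :> rat.
  by apply/prodf_neq0 => i _; exact: natD_neq0.
by field; rewrite D0 -!natrD pnatr_eq0; lia.
Qed.

Lemma rem_ratio_shift n k :
  rem_ratio n.+1 k.+1 = k.+1%:R ^+ 2 * rem_ratio n k / ((k%:R + n.+2%:R) * (k%:R + n.+3%:R)).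
Proof.
have H m : k%:R + m.+1%:R != 0 :> rat by rewrite addrC natD_neq0.
elim: n => [|n IH].
  rewrite rem_ratioS !rem_ratio0 -!natr1; field.
  by rewrite natr1 -!natrD !pnatr_eq0 !addnS.
rewrite rem_ratioS IH rem_ratioS.
have e1 : k.+1%:R - n.+1%:R = k%:R - n%:R :> rat by rewrite -!natr1; ring.
have e2 : k.+1%:R + n.+3%:R = k%:R + n.+4%:R :> rat by rewrite -!natr1; ring.
rewrite e1 e2; field.
by rewrite -!natrD !pnatr_eq0; lia.
Qed.

(** Again a duality between n and k, now for the coefficients of the remainder in the
    basis 1/D_(k+1). *)
Lemma rem_ratio_rec n k :
  n.+1%:R ^+ 3 * rem_ratio n.+1 k + n%:R ^+ 3 * rem_ratio n.-1 k
  + n.*2.+1%:R * (n%:R ^+ 2 + n%:R + 1 + 2 * (k%:R * k.+1%:R)) * rem_ratio n k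
  = 2 * n.*2.+1%:R * k.+1%:R ^+ 2 * rem_ratio n k.+1.
Proof.
case: n => [|n] /=.
  rewrite rem_ratioS !rem_ratio0 expr0n mul0r -!natr1; field.
  by rewrite !natr1 !pnatr_eq0.
have -> : n.+1.*2.+1%:R = 2 * n.+1%:R + 1 :> rat by rewrite -natr1 -mul2n natrM.
rewrite rem_ratio_shift !rem_ratioS -!natr1; field.
by rewrite !natr1 -!natrD !pnatr_eq0; lia.
Qed.
(** The coefficients that orthogonality predicts for Q_n Theta - P_n: there is none
    below k = n, and this is where the p-adic smallness comes from. *)
Definition rem_coef (n k : nat) : rat := (-1) ^+ (k + n) * k`!%:R ^+ 2 * rem_ratio n k.
Definition rem_sum (K n : nat) : rat := \sum_(k < K) rem_coef n k / node_prod k.+1 x.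

(** Multiplication by X in the basis 1/D_(k+1) is X/D_(k+1) = 1/D_k + k(k+1)/D_(k+1);
    with [rem_ratio_rec] the sum telescopes.  The boundary term at k = 0 vanishes
    unless n = 0, where it matches the inhomogeneous term of [apery_op_num]. *)
Lemma apery_op_rem_sum K n :
  apery_op x (rem_sum K) n = 2 * n.*2.+1%:R * rem_coef n K / node_prod K x - 2 * (n == 0%N)%:R.
Proof.
elim: K => [|K IH].
  have -> : apery_op x (rem_sum 0) n = 0 by rewrite /apery_op /rem_sum !big_ord0; ring.
  rewrite node_prod0 divr1 /rem_coef fact0 expr1n mulr1 add0n.
  case: n => [|n]; first by rewrite rem_ratio0 double0 eqxx expr0 invr1 !mulr1 subrr.
  by rewrite /rem_ratio big_ord_recl /= subrr !mul0r !mulr0 subrr.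
have -> : apery_op x (rem_sum K.+1) n = apery_op x (rem_sum K) n + apery_op x (fun m =>
  rem_coef m K / node_prod K.+1 x) n.
  by rewrite /apery_op /rem_sum !big_ord_recr /=; ring.
rewrite IH.
have -> : apery_op x (fun m => rem_coef m K / node_prod K.+1 x) n =
   (2 * n.*2.+1%:R * rem_coef n K.+1 - 2 * n.*2.+1%:R * ((x - 1 - K%:R) * (x +
     K%:R)) * rem_coef n K) / node_prod K.+1 x.
  have -> : rem_coef n K.+1 = - (-1) ^+ (K + n) * K`!%:R ^+ 2 * (K.+1%:R ^+ 2 * rem_ratio n K.+1).
    by rewrite /rem_coef addSn exprS factS natrM; ring.
  have -> : 2 * n.*2.+1%:R * (- (-1) ^+ (K + n) * K`!%:R ^+ 2 * (K.+1%:R ^+ 2 * rem_ratio n K.+1))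
    = - (-1) ^+ (K + n) * K`!%:R ^+ 2 * (2 * n.*2.+1%:R * K.+1%:R ^+ 2 * rem_ratio n K.+1) by ring.
  rewrite -rem_ratio_rec /apery_op /rem_coef.
  case: n {IH} => [|n] /=.
    by rewrite addn1 addn0 [(-1) ^+ K.+1]exprS expr0n /= double0 -natr1; ring.
  by rewrite !addnS [(-1) ^+ (K + n).+2]exprS [(-1) ^+ (K + n).+1]exprS -!natr1; ring.
have := x0 K.+1; rewrite node_prodS mulf_eq0 negb_or => /andP[g0 h0].
by field; move: h0; rewrite mulf_eq0 negb_or g0 => /andP[-> ->].
Qed.

(** The truncation error in Q_n Theta = P_n + R_n.  Working with truncated sums keeps
    all computations inside the rationals. *)
Definition rem_error (K n : nat) : rat := apery_den x n * ifs_sum x K - apery_num x n - rem_sum K n.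

Lemma apery_op_rem_error K n : apery_op x (rem_error K) n =
  - (2 * n.*2.+1%:R * rem_coef n K / node_prod K x).
Proof.
transitivity (apery_op x (apery_den x) n * ifs_sum x K - apery_op x (apery_num x)
  n - apery_op x (rem_sum K) n).
  by rewrite /apery_op /rem_error; ring.
by rewrite apery_op_den apery_op_num apery_op_rem_sum; ring.
Qed.

Lemma rem_error0 K : rem_error K 0 = 0.
Proof.
rewrite /rem_error /apery_den /apery_num /dbinom_comb !big_ord1 !dbinom0 /ifs_sum big_ord0
  !mulr1 mul1r mulr0 subr0.
apply/eqP; rewrite subr_eq0; apply/eqP; apply: eq_bigr => k _.
rewrite /ifs_term /rem_coef rem_ratio0 addn0; field.
by rewrite x0 nat1r pnatr_eq0.
Qed.

End NonVanishing.

(** * Growth of solutions, and least common multiples *)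

(** A sequence of polynomial growth (of order n^A), which dominates the solutions of
    the recurrence. *)
Definition growth (A : rat) (n : nat) : rat := \prod_(k < n) (1 + A / k.+1%:R).

Lemma growthS A n : growth A n.+1 = growth A n * (1 + A / n.+1%:R).
Proof. by rewrite /growth big_ord_recr. Qed.

Lemma growth_ge1 A n : 0 <= A -> 1 <= growth A n.
Proof.
move=> A0; elim: n => [|n IH]; first by rewrite /growth big_ord0.
by rewrite growthS (le_trans IH) // ler_peMr ?(le_trans ler01) // lerDl divr_ge0.
Qed.

Lemma growth1 n : growth 1 n = n.+1%:R.
Proof.
elim: n => [|n IH]; first by rewrite /growth big_ord0.
by rewrite growthS IH -[n.+2%:R]natr1; field; rewrite nat1r pnatr_eq0.
Qed.

Lemma growth_subexp A d : 0 <= A -> 0 < d ->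
  exists2 K, 0 < K & forall n, growth A n <= K * (1 + d) ^+ n.
Proof.
move=> A0 d0; have [N hN] : exists N : nat, A / d < N%:R.
  by exists (Num.bound (A / d)); rewrite archi_boundP // divr_ge0 // ltW.
exists ((1 + A) ^+ N); first by rewrite exprn_gt0 // ltr_pwDl.
have A1 : 1 <= 1 + A by rewrite lerDl.
suff H n : growth A n <= (1 + A) ^+ minn n N * (1 + d) ^+ n.
  move=> n; apply: (le_trans (H n)); apply: ler_wpM2r.
    by rewrite exprn_ge0 // addr_ge0 // ltW.
  by rewrite ler_weXn2l // geq_minr.
have d1 : 1 <= 1 + d by rewrite lerDl ltW.
elim: n => [|n IH]; first by rewrite min0n !expr0 mulr1 /growth big_ord0.
have nn : 0 < n.+1%:R :> rat by rewrite ltr0n.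
have f0 : 0 <= 1 + A / n.+1%:R by rewrite addr_ge0 ?divr_ge0.
have p0 : 0 <= growth A n by rewrite (le_trans ler01) ?growth_ge1.
have [nN|Nn] := ltnP n N.
  rewrite (minn_idPl nN); rewrite (minn_idPl (ltnW nN)) in IH.
  rewrite growthS [X in _ <= X](_ : _ = (1 + A) ^+ n * (1 + d) ^+ n * ((1 + A) * (1 + d))).
    apply: ler_pM => //; apply: (@le_trans _ _ (1 + A)).
      by rewrite lerD2l ler_pdivrMr // ler_peMr // ler1n.
    by rewrite ler_peMr // (le_trans ler01).
  by rewrite !exprSr; ring.
rewrite (minn_idPr (leqW Nn)); rewrite (minn_idPr Nn) in IH.
rewrite growthS exprSr mulrA; apply: ler_pM => //.
rewrite lerD2l ler_pdivrMr // mulrC -ler_pdivrMr // ltW // (lt_le_trans hN) //.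
by rewrite ler_nat leqW.
Qed.

(** The recurrence reads w_(n+1) = w_n + 2X(2n+1) u_n, up to the inhomogeneous term,
    for w_n = n^3 (u_n - u_(n-1)).  So w_n is at most A n^2 times the bound for u, and
    u_(n+1) - u_n = w_(n+1) / (n+1)^3 multiplies that bound by at most 1 + A/(n+1). *)
Lemma apery_op_growth x u c : (forall n, apery_op x u n = c * (n == 0%N)%:R) ->
  exists A C, [/\ 0 <= A, 0 < C & forall n, `|u n| <= C * growth A n].
Proof.
move=> rec; pose H := 2 * `|x * (x - 1)|; pose A := H + `|c|.
have H0 : 0 <= H by rewrite mulr_ge0.
have A0 : 0 <= A by rewrite addr_ge0.
pose C := `|u 0%N| + 1; have C1 : 1 <= C by rewrite lerDr.
exists A, C; split => //; first by rewrite (lt_le_trans ltr01).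
suff H1 n : `|u n| <= C * growth A n /\
    `|n%:R ^+ 3 * (u n - u n.-1)| <= A * n%:R ^+ 2 * (C * growth A n.-1).
  by move=> n; case: (H1 n).
elim: n => [|n [IHu IHw]].
  by rewrite /growth big_ord0 mulr1 expr0n mul0r normr0 expr0n mulr0 mul0r /C lerDl.
set B := C * growth A n.
have B1 : 1 <= B by rewrite mulr_ege1 // growth_ge1.
have wS : n.+1%:R ^+ 3 * (u n.+1 - u n) = n%:R ^+ 3 * (u n - u n.-1)
    + 2 * (x * (x - 1)) * n.*2.+1%:R * u n + c * (n == 0%N)%:R.
  by rewrite -rec /apery_op -!natr1 -mul2n natrM; ring.
have Bm : C * growth A n.-1 <= B.
  rewrite /B; case: (n) => [|m] //=; apply: ler_wpM2l; first by rewrite (le_trans ler01).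
  by rewrite growthS ler_peMr ?(le_trans ler01) ?growth_ge1 // lerDl divr_ge0.
have wB : `|n.+1%:R ^+ 3 * (u n.+1 - u n)| <= A * n.+1%:R ^+ 2 * B.
  rewrite wS; apply: (le_trans (ler_normD _ _)).
  have -> : A * n.+1%:R ^+ 2 * B = A * n%:R ^+ 2 * B + H * n.*2.+1%:R * B + `|c| * n.*2.+1%:R * B.
    by rewrite /A -!natr1 -mul2n natrM; ring.
  apply: lerD; last first.
    rewrite normrM -mulrA; apply: ler_wpM2l => //.
    case: (n) => [|m] /=; first by rewrite normr1 mul1r.
    by rewrite normr0 mulr_ge0 // (le_trans ler01).
  apply: (le_trans (ler_normD _ _)); apply: lerD.
    by apply: (le_trans IHw); apply: ler_wpM2l => //; rewrite mulr_ge0 ?exprn_ge0.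
  rewrite normrM; apply: ler_pM => //.
  by rewrite normrM normrM ger0_norm // [`|n.*2.+1%:R|]ger0_norm.
split=> //.
have nn : 0 < n.+1%:R :> rat by rewrite ltr0n.
have -> : u n.+1 = u n + n.+1%:R ^+ 3 * (u n.+1 - u n) / n.+1%:R ^+ 3.
  by field; rewrite nat1r pnatr_eq0.
rewrite growthS mulrA -/B [B * _]mulrDr mulr1; apply: (le_trans (ler_normD _ _)); apply: lerD => //.
rewrite normrM normfV [`|_ ^+ 3|]ger0_norm ?exprn_ge0 // ler_pdivrMr ?exprn_gt0 //.
apply: (le_trans wB); rewrite le_eqVlt; apply/orP; left; apply/eqP.
by field; rewrite nat1r pnatr_eq0.
Qed.

Definition lcm_upto (n : nat) : nat := \big[lcmn/1%N]_(i < n) i.+1.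

Lemma lcm_uptoS n : lcm_upto n.+1 = lcmn (lcm_upto n) n.+1.
Proof. by rewrite /lcm_upto big_ord_recr. Qed.

Lemma lcm_upto_gt0 n : (0 < lcm_upto n)%N.
Proof. by elim: n => [|n IH]; rewrite ?lcm_uptoS ?lcmn_gt0 ?IH // /lcm_upto big_ord0. Qed.

Lemma dvdn_lcm_upto n m : (0 < m <= n)%N -> (m %| lcm_upto n)%N.
Proof.
elim: n => [|n IH] /andP[m0]; first by case: m m0.
rewrite leq_eqVlt lcm_uptoS => /orP[/eqP->|mn]; first exact: dvdn_lcmr.
by apply: dvdn_trans (dvdn_lcml _ _); apply: IH; rewrite m0.
Qed.

Lemma logn_lcm_upto q n : prime q -> logn q (lcm_upto n) = trunc_log q n.
Proof.
move=> qp; have q1 := prime_gt1 qp.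
elim: n => [|n IH]; first by rewrite /lcm_upto big_ord0 logn1 trunc_log0.
rewrite lcm_uptoS logn_lcm ?lcm_upto_gt0 // IH.
apply/eqP; rewrite eqn_leq geq_max; apply/andP; split.
  apply/andP; split; first by rewrite leq_trunc_log.
  by apply: trunc_log_max => //; apply: dvdn_leq => //; exact: pfactor_dvdnn.
rewrite leq_max; case: (leqP (trunc_log q n.+1) (trunc_log q n)) => //= lt.
have le1 := trunc_logP q1 (ltn0Sn n).
have : (q ^ trunc_log q n.+1 = n.+1)%N.
  apply/eqP; rewrite eqn_leq le1 /= ltnNge; apply/negP => H.
  by move: lt; rewrite ltnNge trunc_log_max.
by move=> {2}<-; rewrite pfactorK.
Qed.

Lemma sum_ltn n t : (t <= n)%N -> (\sum_(j < n) (j < t) = t)%N.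
Proof.
move=> tn; rewrite (eq_bigr (fun j : 'I_n => if (j < t)%N then 1%N else 0%N)).
  by rewrite -big_mkcond (big_ord_narrow tn) sum_nat_const card_ord muln1.
by move=> j _; case: ltnP.
Qed.

(** Chebyshev's identity: the exponent of a prime q on both sides counts the pairs
    (j, k) with q^j k <= n. *)
Lemma prod_lcm_upto n : (\prod_(k < n) lcm_upto (n %/ k.+1) = n`!)%N.
Proof.
apply: eqn_from_log; [by apply: prodn_gt0 => i; exact: lcm_upto_gt0 | exact: fact_gt0 |].
move=> q; have [qp|nq] := boolP (prime q); last first.
  by rewrite /logn (negbTE nq).
have q1 := prime_gt1 qp.
have -> : logn q (\prod_(k < n) lcm_upto (n %/ k.+1)) = (\sum_(k < n) trunc_log q (n %/ k.+1))%N.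
  have : forall k : 'I_n, (0 < lcm_upto (n %/ k.+1))%N by move=> k; exact: lcm_upto_gt0.
  elim: (index_enum _) => [|a s IH] pos; first by rewrite !big_nil logn1.
  rewrite !big_cons lognM ?IH ?logn_lcm_upto ?lcm_upto_gt0 //.
  by rewrite prodn_gt0.
rewrite logn_fact // big_add1 /= big_mkord.
transitivity (\sum_(k < n) \sum_(j < n) (q ^ j.+1 * k.+1 <= n))%N.
  apply: eq_bigr => k _.
  have m0 : (0 < n %/ k.+1)%N by rewrite divn_gt0.
  have mn : (trunc_log q (n %/ k.+1) <= n)%N.
    apply: (leq_trans (ltnW (ltn_expl _ q1))); apply: (leq_trans (trunc_logP q1 m0)).
    exact: leq_div.
  rewrite -[LHS](sum_ltn mn); apply: eq_bigr => j _; congr nat_of_bool.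
  rewrite -leq_divRL //; apply/idP/idP => [H|]; last exact: trunc_log_max.
  by apply: leq_trans (trunc_logP q1 m0); rewrite leq_exp2l.
rewrite exchange_big /=; apply: eq_bigr => j _.
rewrite -[RHS](@sum_ltn n) ?leq_div //; apply: eq_bigr => k _; congr nat_of_bool.
by rewrite leq_divRL ?expn_gt0 ?prime_gt0 // mulnC.
Qed.

(** Each dyadic block of the harmonic series, from m to 2m-1, is at least 2/3, by
    convexity of 1/t at the mean (3m-1)/2. *)
Lemma harmonic_pow2 r :
  2%:R * r%:R / 3%:R <= \sum_(k < (2 ^ r).-1) (k.+1%:R)^-1 :> rat.
Proof.
elim: r => [|r IH]; first by rewrite big_ord0 mulr0 mul0r.
set m := (2 ^ r)%N in IH *.
have m0 : (0 < m)%N by rewrite expn_gt0.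
have -> : ((2 ^ r.+1).-1 = m.-1 + m)%N by rewrite expnS -/m; lia.
rewrite big_split_ord /= -[r.+1%:R]natr1 mulrDr mulrDl; apply: lerD => //.
(* the tangent of 1/t at the mean of the block *)
have step i : (i < m)%N -> (4%:R / (3 * m%:R - 1)) - (2 / (3 * m%:R - 1)) ^+ 2 * (m.-1 + i).+1%:R
     <= ((m.-1 + i).+1%:R)^-1 :> rat.
  move=> im; set c : rat := 2 / _; set t : rat := (_ + i).+1%:R.
  have t0 : 0 < t by rewrite ltr0n.
  have -> : 4%:R / (3 * m%:R - 1) = 2 * c by rewrite /c mulrA -natrM.
  rewrite -subr_ge0.
  have tn0 : t != 0 by rewrite gt_eqF.
  have -> : t^-1 - (2 * c - c ^+ 2 * t) = (1 - c * t) ^+ 2 / t.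
    by move: (c) (t) tn0 => c' t' t'0; field.
  by rewrite divr_ge0 ?sqr_ge0 // ltW.
have D0 : 0 < 3 * m%:R - 1 :> rat.
  by rewrite subr_gt0 -natrM ltr1n; lia.
apply: (@le_trans _ _ (\sum_(i < m) ((4%:R / (3 * m%:R - 1)) - (2 / (3 * m%:R - 1))
  ^+ 2 * (m.-1 + i).+1%:R))); last first.
  by apply: ler_sum => i _; rewrite step.
rewrite sumrB sumr_const card_ord -[_ *+ m]mulr_natr -mulr_sumr.
have -> : \sum_(i < m) (m.-1 + i).+1%:R = m%:R * (3 * m%:R - 1) / 2%:R :> rat.
  have sumS k : \sum_(i < k) (m.-1 + i).+1%:R = k%:R * m%:R + k%:R * (k%:R - 1) / 2%:R :> rat.
    elim: k => [|k IHk]; first by rewrite big_ord0 !mul0r addr0.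
    rewrite big_ord_recr /= IHk -addSn prednK // natrD -[k.+1%:R]natr1; by field.
  by rewrite sumS; field.
have -> : 4%:R / (3 * m%:R - 1) * m%:R - (2 / (3 * m%:R - 1)) ^+ 2 * (m%:R * (3 * m%:R - 1) / 2%:R)
   = 2 * m%:R / (3 * m%:R - 1) :> rat by field; rewrite gt_eqF.
by rewrite (ler_pdivlMr _ _ D0) mulrAC ler_pdivrMr ?ltr0n //; lra.
Qed.

Lemma exists_expr_gt (b B : rat) : 1 < b -> exists n, B < b ^+ n.
Proof.
move=> b1; have d0 : 0 < b - 1 by rewrite subr_gt0.
have bern n : 1 + n%:R * (b - 1) <= b ^+ n.
  elim: n => [|n IH]; first by rewrite mul0r addr0.
  apply: (@le_trans _ _ ((1 + n%:R * (b - 1)) * b)).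
    rewrite -natr1 -subr_ge0.
    have -> : (1 + n%:R * (b - 1)) * b - (1 + (n%:R + 1) * (b - 1)) = n%:R * (b - 1) ^+ 2 by ring.
    by rewrite mulr_ge0 ?sqr_ge0.
  by rewrite exprSr ler_wpM2r // (le_trans ler01) // ltW.
exists (Num.bound (`|B| / (b - 1))); apply: lt_le_trans (bern _).
rewrite (le_lt_trans (ler_norm B)) // ltr_wpDl // -ltr_pdivrMr //.
by rewrite archi_boundP // divr_ge0 // ltW.
Qed.

Lemma leq_fact_exp n : (n`! <= n ^ n)%N.
Proof.
elim: n => // n IH; rewrite factS expnS leq_mul2l /=.
by case: n IH => // n IH; rewrite (leq_trans IH) // leq_exp2r.
Qed.

(** If lcm(1,...,m) >= c^m for all m from M to n = M 2^r, then [prod_lcm_upto] bounds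
    n! from below by c to the power n H, where H is at least 2r/3 up to a bounded error;
    this exceeds n^n for large r because c^(2/3) > 2.  The prime number theorem
    would give every c > e. *)
Lemma lcm_upto_small (c : rat) M : 1 < c -> 8%:R < c ^+ 2 ->
  exists2 n, (M <= n)%N & (lcm_upto n)%:R <= c ^+ n :> rat.
Proof.
move=> c1 c8; have c0 : 0 < c by rewrite (lt_trans ltr01).
wlog M0 : M / (0 < M)%N.
  by move=> th; have [n Mn dn] := th M.+1 isT; exists n; [exact: ltnW | exact: dn].
have b1 : 1 < c ^+ 2 / 8%:R by rewrite ltr_pdivlMr ?ltr0n // mul1r.
have [r hr] := @exists_expr_gt _ (M%:R ^+ (3 * M) * c ^+ 3) b1.
have [n nE] : exists n, n = (M * 2 ^ r)%N by exists (M * 2 ^ r)%N.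
have Mn : (M <= n)%N by rewrite nE leq_pmulr // expn_gt0.
have [/existsP[m /andP[Mm dm]]|/existsPn no] :=
    boolP [exists m : 'I_n.+1, (M <= m)%N && ((lcm_upto m)%:R <= c ^+ m)].
  by exists m.
exfalso.
have big m : (M <= m <= n)%N -> c ^+ m <= (lcm_upto m)%:R.
  move=> /andP[Mm mn]; have := no (Ordinal (mn : (m < n.+1)%N)).
  by rewrite Mm /= -ltNge => /ltW.
have r0 : (0 < 2 ^ r)%N by rewrite expn_gt0.
have rn : ((2 ^ r).-1 <= n)%N by rewrite nE; nia.
pose e := (\sum_(k < (2 ^ r).-1) n %/ k.+1)%N.
have le1 : c ^+ e <= (n`!)%:R.
  rewrite -prod_lcm_upto natr_prod /e -prodrXr.
  have split_prod (G : nat -> rat) : \prod_(k < n) G k =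
      \prod_(k < (2 ^ r).-1) G k * \prod_(k < n - (2 ^ r).-1) G ((2 ^ r).-1 + k)%N.
    have : (n = (2 ^ r).-1 + (n - (2 ^ r).-1))%N by rewrite subnKC.
    by move: (n - _)%N => d ->; rewrite big_split_ord.
  rewrite (split_prod (fun k => (lcm_upto (n %/ k.+1))%:R)).
  rewrite -[X in X <= _]mulr1; apply: ler_pM.
  - by apply: prodr_ge0 => k _; rewrite exprn_ge0 // ltW.
  - exact: ler01.
  - apply: ler_prod => k _; rewrite exprn_ge0 ?(ltW c0) //=. apply: big.
    rewrite leq_div andbT leq_divRL // nE leq_mul2l; apply/orP; right.
    by have := ltn_ord k; lia.
  by rewrite -natr_prod ler1n prodn_gt0 // => i; exact: lcm_upto_gt0.
have le2 : (2 * n * r <= 3 * e + 3 * 2 ^ r)%N.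
  have : \sum_(k < (2 ^ r).-1) (n%:R / k.+1%:R - 1) <= e%:R :> rat.
    rewrite /e natr_sum; apply: ler_sum => k _.
    rewrite lerBlDr natr1 ler_pdivrMr ?ltr0n // -natrM ler_nat mulnC ltnW //.
    by rewrite mulnC ltn_ceil.
  rewrite sumrB -mulr_sumr sumr_const card_ord => H.
  have h := harmonic_pow2 r.
  have {H}H : n%:R * (2%:R * r%:R / 3%:R) - (2 ^ r)%:R <= e%:R :> rat.
    apply: le_trans H; apply: lerB; first by apply: ler_wpM2l.
    by rewrite ler_nat leq_pred.
  rewrite -(ler_nat rat) !natrD !natrM natrX; move: H; rewrite natrX; lra.
have le3 : c ^+ (2 * n * r) <= (n%:R ^+ n) ^+ 3 * c ^+ (3 * 2 ^ r).
  apply: (@le_trans _ _ (c ^+ (3 * e + 3 * 2 ^ r))).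
    by rewrite ler_weXn2l // ltW.
  rewrite exprD ler_pM2r ?exprn_gt0 // mulnC exprM lerXn2r ?nnegrE ?exprn_ge0 ?(ltW c0) //.
  rewrite (le_trans le1) // -natrX ler_nat.
  exact: leq_fact_exp.
move: hr; apply/negP; rewrite -leNgt.
have := le3.
have -> : c ^+ (2 * n * r) = (c ^+ (2 * M * r)) ^+ (2 ^ r).
  by rewrite -exprM; congr (_ ^+ _); rewrite nE; nia.
have -> : (n%:R ^+ n) ^+ 3 * c ^+ (3 * 2 ^ r) = ((n%:R ^+ (3 * M)) * c ^+ 3) ^+ (2 ^ r) :> rat.
  by rewrite exprMn -!exprM; congr (_ ^+ _ * _); rewrite nE; nia.
rewrite ler_pXn2r ?nnegrE ?mulr_ge0 ?exprn_ge0 ?(ltW c0) // => le4.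
have le5 : (c ^+ 2 / 8%:R) ^+ (M * r) <= M%:R ^+ (3 * M) * c ^+ 3.
  rewrite expr_div_n -exprM mulnA ler_pdivrMr ?exprn_gt0 //.
  apply: (le_trans le4); rewrite nE natrM exprMn natrX.
  have -> : (2%:R ^+ r) ^+ (3 * M) = 8%:R ^+ (M * r) :> rat.
    rewrite -exprM (_ : 8%:R = 2%:R ^+ 3 :> rat) ?natrX // -exprM.
    by congr (_ ^+ _); nia.
  by rewrite mulrAC.
apply: le_trans le5; rewrite ler_weXn2l //; last by rewrite leq_pmull.
exact: ltW.
Qed.

(** * Denominators of the approximations *)

Definition genbin (y : rat) (m : nat) : rat := (\prod_(i < m) (y - i%:R)) / m`!%:R.

Lemma prod_ffact (R : comNzRingType) n k :
  \prod_(i < k) (n%:R - i%:R) = (n ^_ k)%:R :> R.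
Proof.
elim: k => [|k IH]; first by rewrite big_ord0 ffactn0.
rewrite big_ord_recr /= IH ffactnSr natrM.
have [kn|nk] := leqP k n; first by rewrite natrB.
by rewrite ffact_small // !mul0r.
Qed.

Lemma genbin_nat n k : genbin n%:R k = 'C(n, k)%:R.
Proof. by rewrite /genbin prod_ffact -bin_ffact natrM mulfK ?fact_neq0. Qed.

Lemma prod_rev y m : \prod_(i < m) (y + i%:R) = \prod_(i < m) (y + m%:R - 1 - i%:R) :> rat.
Proof.
rewrite (reindex_inj rev_ord_inj); apply: eq_bigr => i _ /=.
by rewrite natrB ?ltn_ord // -natr1; ring.
Qed.

Lemma dbinom_genbin k y : dbinom k y = genbin (y - 1) k * genbin (y + k%:R - 1) k.
Proof.
rewrite /dbinom /node_prod big_split /= prod_rev /genbin; field.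
by rewrite fact_neq0.
Qed.

Lemma dbinom_nat_int n k : dbinom k n.+1%:R \is a Num.int.
Proof.
rewrite dbinom_genbin -natr1 addrK addrAC addrK -natrD !genbin_nat.
by rewrite -natrM natr_int.
Qed.

Lemma dvdz_prod_sub (d m : nat) (f g : nat -> int) :
  (forall i, d%:Z %| f i - g i)%Z ->
  (d%:Z %| \prod_(i < m) f i - \prod_(i < m) g i)%Z.
Proof.
move=> fg; elim: m => [|m IH]; first by rewrite !big_ord0 subrr dvdz0.
rewrite !big_ord_recr /=.
have -> : forall A B a b : int, A * a - B * b = (A - B) * a + B * (a - b) by move=> *; ring.
by apply: rpredD; [apply: dvdz_mulr | apply: dvdz_mull; exact: fg].
Qed.

(** Modulo d the step F is invertible, so the product of an arithmetic progression of
    length m is, up to a unit, a product of m consecutive integers. *)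
Lemma dvdz_arith_prod (d F m : nat) (b : int) : (0 < d)%N -> coprime d F -> (d %| m`!)%N ->
  (d%:Z %| \prod_(i < m) (b - i%:R * F%:R))%Z.
Proof.
move=> d0 dF dm; have [u _] := Bezoutl F d0; rewrite (eqP dF) => duF.
(* as u F = -1 modulo d, multiplying b - i F by -u gives c - i *)
pose c := `|((- b * u%:Z) %% d%:Z)%Z|%N.
have cE : c%:Z = ((- b * u%:Z) %% d%:Z)%Z.
  by rewrite /c gez0_abs // modz_ge0 // -lt0n.
have : (d%:Z %| \prod_(i < m) ((b - i%:R * F%:R) * - u%:Z) - \prod_(i < m) (c%:R - i%:R))%Z.
  apply: (@dvdz_prod_sub d m (fun i => (b - i%:R * F%:R) * - u%:Z) (fun i => c%:R - i%:R)) => i.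
  have -> : (b - i%:R * F%:R) * - u%:Z - (c%:R - i%:R)
      = (- b * u%:Z - c%:Z) + i%:R * (1 + u * F)%N%:Z.
    by rewrite PoszD PoszM !natz; ring.
  apply: rpredD; last by rewrite dvdz_mull.
  by rewrite -eqz_mod_dvd cE modz_mod.
rewrite prod_ffact big_split /= prodr_const card_ord => H.
have {H} : (d%:Z %| \prod_(i < m) (b - i%:R * F%:R) * (- u%:Z) ^+ m)%Z.
  rewrite -[X in (_ %| X)%Z](subrK (c ^_ m)%:R) rpredD // -bin_ffact natz.
  by rewrite PoszM dvdz_mull.
rewrite Gauss_dvdzl // coprimezE abszX abszN coprimeXr //=.
have : coprime d (u * F) by apply: coprime_dvdl duF _; rewrite add1n coprimeSn.
by rewrite coprimeMr => /andP[].
Qed.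

Section Denominators.
Variables (p : nat) (p_pr : prime p) (k F : nat) (hF : F = (p ^ k)%N) (a : int).

Let F0 : (0 < F)%N. Proof. by rewrite hF expn_gt0 prime_gt0. Qed.
Let Fn0 : F%:R != 0 :> rat. Proof. by rewrite pnatr_eq0 -lt0n. Qed.

(** The power of p that makes C(b/F, m) an integer for all m <= n. *)
Definition ppart_den (n : nat) : nat := (F ^ n * p ^ logn p n`!)%N.

Lemma ppart_den_dvd m n : (m <= n)%N -> (ppart_den m %| ppart_den n)%N.
Proof.
move=> mn; apply: dvdn_mul; first exact: dvdn_exp2l.
apply: dvdn_exp2l; apply: dvdn_leq_log; first exact: fact_gt0.
by rewrite -(bin_fact mn) mulnCA dvdn_mulr.
Qed.

Lemma genbin_int (b : int) m n : (m <= n)%N ->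
  (ppart_den n)%:R * genbin (b%:~R / F%:R) m \is a Num.int.
Proof.
move=> mn; have /dvdnP[q ->] := ppart_den_dvd mn.
rewrite natrM -mulrA rpredM ?natr_int // /ppart_den natrM /genbin.
have [d cpd dE] := pfactor_coprime p_pr (fact_gt0 m).
have d0 : (0 < d)%N by have := fact_gt0 m; rewrite dE muln_gt0 => /andP[].
have Fd : coprime d F by rewrite hF coprimeXr // coprime_sym.
have /(dvdz_arith_prod b d0 Fd) : (d %| m`!)%N by rewrite dE dvdn_mulr.
move=> /Qint_dvdz; set P := \prod_(i < m) (b - _); set v := (p ^ _)%N in dE * => dint.
suff -> : (F ^ m)%:R * v%:R * ((\prod_(i < m) (b%:~R / F%:R - i%:R)) / m`!%:R) =
  P%:~R / d%:Z%:~R :> rat by [].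
have -> : P%:~R = F%:R ^+ m * \prod_(i < m) (b%:~R / F%:R - i%:R) :> rat.
  rewrite /P rmorph_prod -[X in _ ^+ X]card_ord -prodr_const -big_split /=.
  apply: eq_bigr => i _; rewrite rmorphB rmorphM /= !rmorph_nat; field.
  by [].
rewrite dE natrM natrX; field.
by rewrite !pnatr_eq0 -!lt0n d0 expn_gt0 prime_gt0.
Qed.

Definition point : rat := a%:~R / F%:R.

Lemma point_shift (z : int) : point + z%:~R = (a + z * F%:R)%:~R / F%:R.
Proof. by rewrite /point rmorphD rmorphM rmorph_nat /=; field. Qed.

Lemma genbin_point_int (z : int) m n : (m <= n)%N ->
  (ppart_den n)%:R * genbin (point + z%:~R) m \is a Num.int.
Proof. by move=> mn; rewrite point_shift genbin_int. Qed.

Definition common_den (n : nat) : nat := (lcm_upto n ^ 3 * ppart_den n ^ 2)%N.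

Lemma dbinom_point_int i n : (i <= n)%N -> (ppart_den n ^ 2)%:R * dbinom i point \is a Num.int.
Proof.
move=> le_in; rewrite dbinom_genbin natrM.
have -> : point - 1 = point + (-1)%:~R by [].
have -> : point + i%:R - 1 = point + (i%:Z - 1)%:~R by rewrite rmorphB /= addrA.
by rewrite mulrACA rpredM ?genbin_point_int.
Qed.

Lemma apery_den_int n : (common_den n)%:R * apery_den point n \is a Num.int.
Proof.
rewrite /common_den natrM -mulrA rpredM ?natr_int // /apery_den /dbinom_comb mulr_sumr rpred_sum
  // => i _.
by rewrite mulr1 mulrCA rpredM ?dbinom_nat_int ?dbinom_point_int // -ltnS.
Qed.

(** The Beta integral of t^j (1-t)^m, expanded: it shows that 1/((m+j+1) C(m+j,j)) is an
    integral combination of 1/l for l <= m+j+1. *)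
Lemma beta_sum m j : (m`! * j`!)%:R / (m + j).+1`!%:R = altsum m (fun i => (j.+1%:R + i%:R)^-1).
Proof.
rewrite altsum_partial_fraction; last by move=> i _; exact: natD_neq0.
have P0 : j`!%:R * \prod_(i < m.+1) (j.+1%:R + i%:R) = (m + j).+1`!%:R :> rat.
  elim: (m) => [|l IH]; first by rewrite big_ord1 addr0 add0n factS natrM mulrC.
  by rewrite big_ord_recr /= mulrA IH -natrD addSn [in RHS]factS natrM mulrC addSn addnS addnC.
rewrite -P0 natrM; field; rewrite fact_neq0 /= ?andbT.
by apply/prodf_neq0 => i _; exact: natD_neq0.
Qed.

Lemma beta_int m j n : (m + j < n)%N ->
  ((lcm_upto n)%:R * ((m`! * j`!)%:R / (m + j).+1`!%:R) : rat) \is a Num.int.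
Proof.
move=> mjn; rewrite beta_sum mulr_sumr rpred_sum // => i _.
have im : (i <= m)%N by rewrite -ltnS.
have /dvdnP[q ->] : (j.+1 + i %| lcm_upto n)%N by apply: dvdn_lcm_upto; rewrite addSn /=; lia.
rewrite mulrCA rpredM //.
  by rewrite rpredM ?natr_int // rpredX // rpredN natr_int.
by rewrite -natrD natrM mulfK ?natr_int // pnatr_eq0 addSn.
Qed.

Hypothesis node_prod0 : forall i, node_prod i point != 0.

(** In the product of D_i with a term of index j < i of the inverse factorial series the
    factors up to j cancel.  What remains is two generalized binomial coefficients, two
    Beta values and 1/(j+1): whence three factors lcm(1,...,n). *)
Lemma dbinom_ifs_term i j : (j < i)%N -> dbinom i point * ifs_term point j =
  (-1) ^+ j * ((i - j.+1)`! * j`!)%:R / i`!%:R * (((i - j.+1)`! * j`!)%:R / i`!%:R) / j.+1%:R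
  * (genbin (point + (- (j.+2)%:Z)%:~R) (i - j.+1) * genbin (point + (i%:Z - 1)%:~R) (i - j.+1)).
Proof.
move=> /subnKC; move: (i - j.+1)%N => m im.
have gE : node_prod i point = node_prod j.+1 point *
    (\prod_(l < m) (point + (- (j.+2)%:Z)%:~R - l%:R) * \prod_(l < m) (point + j.+1%:R + l%:R)).
  rewrite -im /node_prod big_split_ord /= -big_split /=; congr (_ * _); apply: eq_bigr => l _.
  have -> : (- (j.+2)%:Z)%:~R = - (j%:R + 1 + 1) :> rat by rewrite mulrNz !natr1.
  by rewrite natrD -!natr1; congr (_ * _); ring.
have eqx : point + (i%:Z - 1)%:~R = point + j.+1%:R + m%:R - 1.
  by rewrite -im rmorphB PoszD rmorphD /= !addrA.
rewrite /dbinom /ifs_term gE prod_rev eqx /genbin !natrM.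
field.
by rewrite !fact_neq0 node_prod0 nat1r pnatr_eq0.
Qed.

Lemma apery_num_int n : (common_den n)%:R * apery_num point n \is a Num.int.
Proof.
rewrite /apery_num /dbinom_comb mulr_sumr rpred_sum // => i _.
rewrite -mulrA mulrCA rpredM ?dbinom_nat_int // /ifs_sum mulr_sumr mulr_sumr rpred_sum // => j _.
have ji := ltn_ord j; have ni : (i <= n)%N by rewrite -ltnS.
rewrite dbinom_ifs_term // /common_den !expnS !expn0 !muln1 !natrM.
set m := (i - j.+1)%N; have iE : (m + j).+1 = i by rewrite /m; lia.
have bi : ((lcm_upto n)%:R * ((m`! * j`!)%:R / i`!%:R) : rat) \is a Num.int.
  by have := @beta_int m j n; rewrite iE; apply; lia.
have ji' : ((lcm_upto n)%:R / j.+1%:R : rat) \is a Num.int.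
  by apply: (@Qint_dvdz (lcm_upto n) j.+1); apply: dvdn_lcm_upto; lia.
have mn : (m <= n)%N by rewrite /m; lia.
have g1 := genbin_point_int (- (j.+2)%:Z) mn.
have g2 := genbin_point_int (i%:Z - 1) mn.
rewrite natrM in bi.
set u := (lcm_upto n)%:R in bi ji' *.
have sg : (-1) ^+ j \is a @Num.int rat by rewrite rpredX // rpredN natr_int.
suff E (y : rat) : y = ((-1) ^+ j * (u * (m`!%:R * j`!%:R / i`!%:R))
  * (u * (m`!%:R * j`!%:R / i`!%:R)) *
  (u / j.+1%:R)) * ((ppart_den n)%:R * genbin (point +
    (- (j.+2)%:Z)%:~R) m) * ((ppart_den n)%:R * genbin (point + (i%:Z - 1)%:~R) m)
  -> y \is a Num.int.
  by apply: E; rewrite /ppart_den !natrM; ring.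
move=> ->; apply: rpredM g2; apply: rpredM g1; apply: rpredM ji'; apply: rpredM (bi);
  apply: rpredM (bi); exact: sg.
Qed.

End Denominators.

(** * The p-adic absolute value of rationals *)

Section RationalNorm.
Context {p : nat} (p_pr : prime p).
Local Notation Zp := (padic_int p_pr).
Local Notation Qp := (padic p_pr).

Lemma padic_intr_eq0 (z : int) : (z%:~R == 0 :> Qp) = (z == 0).
Proof.
case: (intP z) => [|n|n]; first by rewrite !eqxx.
  by rewrite -pmulrn padic_natr_eq0.
by rewrite mulrNz -pmulrn !oppr_eq0 padic_natr_eq0.
Qed.

Lemma ratr_frac (a b : int) : b != 0 -> ratr (a%:~R / b%:~R) = a%:~R / b%:~R :> Qp.
Proof.
move=> b0; rewrite /ratr; set x : rat := _ / _.
have b0' : b%:~R != 0 :> rat by rewrite intr_eq0.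
have E : numq x * b = a * denq x.
  apply: (@intr_inj rat); rewrite !rmorphM /=; apply/eqP.
  by rewrite -eqr_div ?intr_eq0 ?denq_eq0 // divq_num_den.
apply/eqP; rewrite eqr_div ?padic_intr_eq0 ?denq_eq0 //.
by rewrite -!rmorphM /= E.
Qed.

(** Q_p has characteristic 0, so [ratr] embeds the rationals into it. *)
Lemma padic_ratrM (x y : rat) : ratr (x * y) = ratr x * ratr y :> Qp.
Proof.
rewrite -[x in LHS]divq_num_den -[y in LHS]divq_num_den mulf_div -!rmorphM /=.
by rewrite ratr_frac ?mulf_neq0 ?denq_eq0 // !rmorphM /= -mulf_div.
Qed.

Lemma padic_ratrD (x y : rat) : ratr (x + y) = ratr x + ratr y :> Qp.
Proof.
rewrite -[x in LHS]divq_num_den -[y in LHS]divq_num_den addf_div ?intr_eq0 ?denq_eq0 //.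
rewrite -!rmorphM -rmorphD /= ratr_frac ?mulf_neq0 ?denq_eq0 //.
by rewrite !rmorphD !rmorphM /= -addf_div // padic_intr_eq0 denq_eq0.
Qed.

Lemma padic_ratr_eq0 (x : rat) : (ratr x == 0 :> Qp) = (x == 0).
Proof.
by rewrite /ratr mulf_eq0 invr_eq0 !padic_intr_eq0 (negbTE (denq_neq0 x)) orbF numq_eq0.
Qed.

Lemma padic_ratr0 : ratr 0 = 0 :> Qp. Proof. exact: (ratr_nat _ 0). Qed.
Lemma padic_ratr1 : ratr 1 = 1 :> Qp. Proof. exact: (ratr_nat _ 1). Qed.

Lemma padic_ratrN (x : rat) : ratr (- x) = - ratr x :> Qp.
Proof. by apply/eqP; rewrite -addr_eq0 -padic_ratrD addNr padic_ratr0. Qed.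

Lemma padic_ratrV (x : rat) : ratr x^-1 = (ratr x)^-1 :> Qp.
Proof.
have [->|x0] := eqVneq x 0; first by rewrite invr0 padic_ratr0 invr0.
by apply: (mulfI (_ : ratr x != 0)); rewrite ?padic_ratr_eq0 // -padic_ratrM !divff
  ?padic_ratr_eq0 // padic_ratr1.
Qed.

(** All estimates concern rational numbers, on which the absolute value is induced by
    their embedding in Q_p. *)
Definition pnorm (x : rat) : rat := padic_norm (ratr x : Qp).

Lemma pnorm_ge0 x : 0 <= pnorm x. Proof. exact: padic_norm_ge0. Qed.

Lemma pnorm_eq0 x : (pnorm x == 0) = (x == 0).
Proof. by rewrite /pnorm padic_norm_eq0 padic_ratr_eq0. Qed.

Lemma pnorm_gt0 x : (0 < pnorm x) = (x != 0).
Proof. by rewrite lt_def pnorm_eq0 pnorm_ge0 andbT. Qed.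

Lemma pnorm0 : pnorm 0 = 0. Proof. by apply/eqP; rewrite pnorm_eq0. Qed.

Lemma pnormM x y : pnorm (x * y) = pnorm x * pnorm y.
Proof. by rewrite /pnorm padic_ratrM padic_normM. Qed.

Lemma pnormN x : pnorm (- x) = pnorm x.
Proof. by rewrite /pnorm padic_ratrN padic_normN. Qed.

Lemma pnormD x y : pnorm (x + y) <= Num.max (pnorm x) (pnorm y).
Proof. by rewrite /pnorm padic_ratrD padic_normD. Qed.

Lemma pnorm_natE n : pnorm n%:R = zp_norm (n%:R : Zp).
Proof. by rewrite /pnorm ratr_nat -padic_norm_tofrac rmorph_nat. Qed.

Lemma pnorm1 : pnorm 1 = 1.
Proof. by rewrite (pnorm_natE 1) zp_norm1. Qed.

Lemma pnormV x : pnorm x^-1 = (pnorm x)^-1.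
Proof.
have [->|x0] := eqVneq x 0; first by rewrite invr0 pnorm0 invr0.
by apply: (mulfI (_ : pnorm x != 0)); rewrite ?pnorm_eq0 // -pnormM !divff ?pnorm_eq0 ?pnorm1.
Qed.

Lemma pnormX x n : pnorm (x ^+ n) = pnorm x ^+ n.
Proof. by elim: n => [|n IH]; rewrite ?expr0 ?pnorm1 // !exprS pnormM IH. Qed.

Lemma pnorm_sign n : pnorm ((-1) ^+ n) = 1.
Proof. by rewrite pnormX pnormN pnorm1 expr1n. Qed.

Lemma pnorm_prod (I : Type) (r : seq I) (f : I -> rat) :
  pnorm (\prod_(i <- r) f i) = \prod_(i <- r) pnorm (f i).
Proof. exact: (big_morph pnorm pnormM pnorm1). Qed.

Lemma pnorm_le_add x y B : pnorm x <= B -> pnorm y <= B -> pnorm (x + y) <= B.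
Proof. by move=> xB yB; apply: (le_trans (pnormD x y)); rewrite ge_max xB. Qed.

Lemma pnorm_sum (I : Type) (r : seq I) (P : pred I) (f : I -> rat) B : 0 <= B ->
  (forall i, P i -> pnorm (f i) <= B) -> pnorm (\sum_(i <- r | P i) f i) <= B.
Proof.
move=> B0 fB; elim/big_ind: _ => //; first by rewrite pnorm0.
by move=> x y; exact: pnorm_le_add.
Qed.

Lemma pnorm_dom x y : pnorm y < pnorm x -> pnorm (x + y) = pnorm x.
Proof.
move=> yx; apply/le_anti; rewrite pnorm_le_add ?(ltW yx) //=.
have [//|H] := leP (pnorm x) (pnorm (x + y)).
have : pnorm x <= Num.max (pnorm (x + y)) (pnorm (- y)).
  by rewrite -[x in pnorm x](addrK y) pnormD.
by rewrite pnormN le_max => /orP[]; rewrite leNgt ?H ?yx.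
Qed.

Lemma pnorm_nat_le n m : (pnorm n%:R <= p%:R ^- m) = (p ^ m %| n)%N.
Proof. by rewrite pnorm_natE zp_norm_le residue_nat. Qed.

Lemma pnorm_nat n : (0 < n)%N -> pnorm n%:R = p%:R ^- logn p n.
Proof.
move=> n0; rewrite pnorm_natE /zp_norm.
have nz : n%:R != 0 :> Zp.
  by rewrite -zp_norm_eq0 -pnorm_natE pnorm_eq0 pnatr_eq0 -lt0n.
rewrite (negbTE nz); suff -> : zp_val (n%:R : Zp) = logn p n by [].
have E m : (m <= zp_val (n%:R : Zp))%N = (m <= logn p n)%N.
  by rewrite -residue_eq0 // residue_nat -/(dvdn _ _) pfactor_dvdn.
by apply/eqP; rewrite eqn_leq -E leqnn E leqnn.
Qed.

Lemma pnorm_nat_le1 n : pnorm n%:R <= 1.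
Proof. by have := pnorm_nat_le n 0; rewrite expr0 invr1 dvd1n. Qed.

Lemma pnorm_int_abs (z : int) : pnorm z%:~R = pnorm `|z|%N%:R.
Proof.
by case: (intP z) => [|n|n] //; rewrite mulrNz pnormN abszN.
Qed.

Lemma pnorm_int_le1 x : x \is a Num.int -> pnorm x <= 1.
Proof. by move=> /intrP[z ->]; rewrite pnorm_int_abs pnorm_nat_le1. Qed.

(** The product formula, as an inequality: an integer is divisible by the power of p
    that its p-adic absolute value indicates. *)
Lemma pnorm_int_ge x : x \is a Num.int -> x != 0 -> 1 <= `|x| * pnorm x.
Proof.
move=> /intrP[z ->]; rewrite intr_eq0 => z0; rewrite pnorm_int_abs -intr_norm -abszE.
have a0 : (0 < `|z|)%N by rewrite absz_gt0.
rewrite pnorm_nat // ler_pdivlMr ?expp_rat_gt0 // mul1r -natrX ler_nat.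
by rewrite dvdn_leq // pfactor_dvdnn.
Qed.

Lemma pnorm_invn n m : (0 < n <= m)%N -> pnorm n%:R^-1 <= m%:R.
Proof.
case/andP=> n0 nm; rewrite pnormV pnorm_nat // invrK -natrX ler_nat.
by apply: leq_trans nm; rewrite dvdn_leq // pfactor_dvdnn.
Qed.

Lemma pnorm_altsum m (f : nat -> rat) B : 0 <= B ->
  (forall i, (i <= m)%N -> pnorm (f i) <= B) -> pnorm (altsum m f) <= B.
Proof.
move=> B0 fB; apply: pnorm_sum => // i _.
rewrite 2!pnormM pnorm_sign mul1r -[X in _ <= X]mul1r.
by apply: ler_pM; rewrite ?pnorm_ge0 ?pnorm_nat_le1 // fB // -ltnS.
Qed.

(** Immediate from [beta_sum], since |1/l| <= l. *)
Lemma pnorm_beta m j : pnorm ((m`! * j`!)%:R / (m + j).+1`!%:R) <= (m + j).+1%:R.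
Proof.
rewrite beta_sum; apply: pnorm_altsum => // i im.
by rewrite -natrD pnorm_invn // addSn /= ltnS addnC leq_add2r.
Qed.

(** Up to an integer factor the ratio is the Beta value k!^2/(2k+1)!, whose absolute
    value is at most 2k+1. *)
Lemma rem_ratio_fact n k : (n <= k)%N ->
  rem_ratio n k = 'C(k.*2.+1, k - n)%:R * ((k`! * k`!)%:R / k.*2.+1`!%:R).
Proof.
move=> nk; rewrite /rem_ratio prod_ffact.
have -> : \prod_(i < n.+1) (k.+1%:R + i%:R) = (k + n).+1`!%:R / k`!%:R :> rat.
  elim: (n) => [|m IH]; first by rewrite big_ord1 addr0 addn0 factS natrM mulfK ?fact_neq0.
  by rewrite big_ord_recr /= IH -natrD addSn !addnS [in RHS]factS [in RHS]natrM mulrAC [X in X /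
    _]mulrC.
have -> : (k`! * k`! = k`! * (k ^_ n * (k - n)`!))%N by rewrite ffact_fact.
have /bin_fact : (k - n <= k.*2.+1)%N by lia.
have -> : (k.*2.+1 - (k - n) = (k + n).+1)%N by lia.
have : (0 < 'C(k.*2.+1, k - n))%N by rewrite bin_gt0; lia.
move: ('C(_, _)) (k.*2.+1)`! => C N C0 <-.
move: (k ^_ n) (k + n).+1 => A T; rewrite !natrM; field.
by rewrite !fact_neq0 pnatr_eq0 -lt0n C0.
Qed.

Lemma rem_ratio_eq0 n k : (k < n)%N -> rem_ratio n k = 0.
Proof. by move=> kn; rewrite /rem_ratio prod_ffact ffact_small ?mul0r. Qed.

Lemma pnorm_rem_ratio n k : pnorm (rem_ratio n k) <= k.*2.+1%:R.
Proof.
have [nk|kn] := leqP n k; last by rewrite rem_ratio_eq0 // pnorm0.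
rewrite rem_ratio_fact // pnormM -[X in _ <= X]mul1r.
apply: ler_pM; rewrite ?pnorm_ge0 ?pnorm_nat_le1 //.
by have := pnorm_beta k k; rewrite addnn.
Qed.

Lemma pnorm_rem_coef n k : pnorm (rem_coef n k) <= k.*2.+1%:R * pnorm k`!%:R ^+ 2.
Proof.
rewrite /rem_coef 2!pnormM pnorm_sign mul1r pnormX mulrC.
by apply: ler_wpM2r; rewrite ?exprn_ge0 ?pnorm_ge0 ?pnorm_rem_ratio.
Qed.

End RationalNorm.

(** * Smallness of the remainder at a/F *)

Lemma poly_geom_small (C e : rat) : 0 < e ->
  exists N, forall n, (N <= n)%N -> C * n.+1%:R ^+ 3 <= e * 2%:R ^+ n.
Proof.
(* (11/10)^3 < 2, so the cube of n+1 is negligible against 2^n *)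
move=> e0; have [K K0 hK] := @growth_subexp 1 (1 / 10%:R) ler01 ltac:(lra).
have [r rE] : exists r : rat, r = 1 + 1 / 10%:R by eexists.
rewrite -rE in hK.
have r0 : 0 < r by rewrite rE; lra.
have b1 : 1 < 2%:R / r ^+ 3.
  by rewrite ltr_pdivlMr ?exprn_gt0 // mul1r rE; lra.
have [N hN] := @exists_expr_gt _ (`|C| * K ^+ 3 / e) b1.
exists N => n Nn.
apply: (@le_trans _ _ (`|C| * (K * r ^+ n) ^+ 3)).
  apply: (@le_trans _ _ (`|C| * n.+1%:R ^+ 3)); first by rewrite ler_wpM2r ?exprn_ge0 ?ler_norm.
  rewrite ler_wpM2l // lerXn2r ?nnegrE ?mulr_ge0 ?exprn_ge0 ?(ltW K0) ?(ltW r0) //.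
  by rewrite -growth1.
have h := lt_le_trans hN (ler_weXn2l (ltW b1) Nn).
have rn0 : 0 < (r ^+ 3) ^+ n by rewrite !exprn_gt0.
move: h; rewrite ltr_pdivrMr // expr_div_n mulrAC ltr_pdivlMr // => /ltW h.
by rewrite exprMn mulrA exprAC [leRHS]mulrC.
Qed.

Lemma expr_mono (u v : rat) n : 0 <= u -> u <= v -> u ^+ n <= v ^+ n.
Proof. by move=> u0 uv; apply: lerXn2r => //; rewrite nnegrE // (le_trans u0). Qed.

Lemma prime_lt5 q : prime q -> (q < 5)%N -> q = 2%N \/ q = 3%N.
Proof. by case: q => [|[|[|[|[|q]]]]] //; [left | right]. Qed.

(** 25^27 <= 9^40, by repeated cubing: evaluating these numerals directly would be
    costly, and for the same reason they enter as variables.  The constant 2382/1000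
    rounds up 25^3/9^4, and 1502/1000 rounds up its cube over 9. *)
Lemma pow_25_9 (u w : rat) : u = 25%:R -> w = 9%:R -> u ^+ 27 <= w ^+ 27 * w ^+ 13.
Proof.
move=> uE wE; have u0 : 0 <= u by rewrite uE.
have w0 : 0 <= w by rewrite wE.
have [c cE] : exists c : rat, c = 2382%:R / 1000%:R := ex_intro _ _ (erefl _).
have [d dE] : exists d : rat, d = 1502%:R / 1000%:R := ex_intro _ _ (erefl _).
have h3 : u ^+ 3 <= c * w ^+ 4 by rewrite uE wE cE; lra.
have cd : c ^+ 3 <= d * w by rewrite cE dE wE; lra.
have dw : d ^+ 3 <= w by rewrite dE wE; lra.
have h9 : u ^+ 9 <= d * w ^+ 13.
  have -> : u ^+ 9 = (u ^+ 3) ^+ 3 by ring.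
  apply: le_trans (expr_mono 3 (exprn_ge0 _ u0) h3) _.
  have -> : (c * w ^+ 4) ^+ 3 = c ^+ 3 * w ^+ 12 by ring.
  have -> : d * w ^+ 13 = d * w * w ^+ 12 by ring.
  exact: (ler_wpM2r (exprn_ge0 12 w0) cd).
have -> : u ^+ 27 = (u ^+ 9) ^+ 3 by ring.
apply: le_trans (expr_mono 3 (exprn_ge0 _ u0) h9) _.
have -> : (d * w ^+ 13) ^+ 3 = d ^+ 3 * w ^+ 39 by ring.
have -> : w ^+ 27 * w ^+ 13 = w * w ^+ 39 by ring.
exact: (ler_wpM2r (exprn_ge0 39 w0) dw).
Qed.

Lemma exp2_le_sqr (F j : nat) : (1 < F)%N -> 2%:R ^+ j <= F%:R ^+ (2 * j) :> rat.
Proof.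
by move=> F1; rewrite exprM; apply: expr_mono => //; rewrite -natrX ler_nat; nia.
Qed.

Section Analysis.
Context {p : nat} (p_pr : prime p) (k F : nat).
Hypotheses (hF : F = (p ^ k)%N) (F_gt2 : (2 < F)%N).
Local Notation pnorm := (pnorm p_pr).

Let F0 : 0 < F%:R :> rat. Proof. by rewrite ltr0n; lia. Qed.
Let F2 : 2%:R <= F%:R :> rat. Proof. by rewrite ler_nat; lia. Qed.

Lemma pnorm_F : pnorm F%:R = F%:R^-1.
Proof. by rewrite pnorm_nat ?hF ?expn_gt0 ?prime_gt0 // pfactorK // natrX. Qed.

Lemma pnorm_fact_le1 j : pnorm j`!%:R ^+ 2 <= 1.
Proof. by rewrite exprn_ile1 ?pnorm_ge0 ?pnorm_nat_le1. Qed.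

(** The only place where F > 2 is used in its full strength.  For p >= 5 already
    25 <= F^2.  For p = 2 one has F >= 4, and v(j!) >= j/2 gives the rate 16 * 2.  For
    p = F = 3 the rate is 9 * 3^(26/27), about 25.9, if v(j!) is bounded below by the
    multiples of 3, 9 and 27 only; blocks of length 27 avoid fractional exponents. *)
Lemma pnorm_fact_geom :
  exists2 C, 0 < C & forall j, pnorm j`!%:R ^+ 2 * 25%:R ^+ j <= C * F%:R ^+ (2 * j).
Proof.
have k0 : (0 < k)%N by case: (k) hF F_gt2 => // ->.
have pF : (p <= F)%N by rewrite hF -[leqLHS]expn1 leq_exp2l ?prime_gt1.
have [p5|] := leqP 5 p.
  exists 1 => // j; rewrite mul1r exprM.
  apply: (@le_trans _ _ (25%:R ^+ j)); first by rewrite ler_piMl ?exprn_ge0 ?pnorm_fact_le1.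
  by apply: expr_mono; first exact: ler0n; rewrite -natrX ler_nat; nia.
have pn j : pnorm j`!%:R ^+ 2 = (p%:R ^+ 2) ^- logn p j`! .
  by rewrite pnorm_nat ?fact_gt0 // -exprVn -!exprVn -!exprM mulnC.
have pos m : 0 < (p%:R ^+ 2) ^+ m :> rat by rewrite !exprn_gt0 // ltr0n prime_gt0.
move=> /(prime_lt5 p_pr)[p2|p3].
- have F4 : (4 <= F)%N.
    move: F_gt2; rewrite hF p2; case: (k) => [|[|m]] // _; rewrite !expnS.
    by have := expn_gt0 2 m; lia.
  have vl j : (j %/ 2 <= logn p j`!)%N.
    rewrite logn_fact // p2; case: j => // j.
    by rewrite big_nat_recl // expn1 leq_addr.
  exists 2 => // j; rewrite pn mulrC ler_pdivrMr //.
  apply: (@le_trans _ _ (2 * 16%:R ^+ j * 4%:R ^+ (j %/ 2))).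
    rewrite {1 2}(divn_eq j 2); set h := (j %/ 2)%N.
    have := ltn_pmod j (isT : (0 < 2)%N); move: (j %% 2)%N => r r2.
    rewrite !exprD (mulnC h) !exprM.
    have -> : 2 * ((16%:R ^+ 2) ^+ h * 16%:R ^+ r) * 4%:R ^+ h =
       ((16%:R ^+ 2 * 4%:R) ^+ h) * (2 * 16%:R ^+ r) :> rat.
      rewrite [in RHS]exprMn; move: ((16%:R ^+ 2) ^+ h) (16%:R ^+ r) (4%:R ^+ h) => u v w; ring.
    apply: ler_pM; [exact: exprn_ge0 | exact: exprn_ge0 | |].
      by apply: expr_mono; [exact: exprn_ge0 | lra].
    by case: r r2 => [|[|r]] r2; [rewrite !expr0; lra | rewrite !expr1; lra | lia].
  apply: ler_pM; [by rewrite mulr_ge0 ?exprn_ge0|exact: exprn_ge0| |].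
    rewrite ler_wpM2l // exprM; apply: expr_mono; first exact: ler0n.
    by rewrite -natrX ler_nat; nia.
  apply: (@le_trans _ _ ((p%:R ^+ 2) ^+ (j %/ 2))).
    rewrite p2; apply: expr_mono; [lra | lra].
  rewrite p2 in vl *; apply: ler_weXn2l; [lra | exact: vl].
have vl j : (13 * (j %/ 27) <= logn p j`!)%N.
  rewrite logn_fact // p3; case: (ltnP j 27) => [/divn_small->//|j27].
  have le3 (G : nat -> nat) : (G 1 + G 2 + G 3 <= \sum_(1 <= l < j.+1) G l)%N.
    case: (j) j27 => [|[|[|i]]] // _.
    by rewrite 3?big_nat_recl // !addnA leq_addr.
  apply: leq_trans (le3 (fun l => (j %/ 3 ^ l)%N)).
  have -> : (3 ^ 1 = 3)%N by []. 
  have -> : (3 ^ 2 = 9)%N by []. 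
  have -> : (3 ^ 3 = 27)%N by [].
  lia.
have [u uE] : exists u : rat, u = 25%:R := ex_intro _ _ (erefl _).
have [w wE] : exists w : rat, w = 9%:R := ex_intro _ _ (erefl _).
have u1 : 1 <= u by rewrite uE; lra.
have w1 : 1 <= w by rewrite wE; lra.
have u0 : 0 <= u by apply: le_trans u1.
have w0 : 0 <= w by apply: le_trans w1.
have uw : u ^+ 27 <= w ^+ 27 * w ^+ 13 by apply: pow_25_9.
exists (u ^+ 27); first by rewrite exprn_gt0 // (lt_le_trans ltr01).
move=> j; rewrite pn mulrC ler_pdivrMr // -uE.
apply: (@le_trans _ _ (u ^+ 27 * w ^+ j * w ^+ (13 * (j %/ 27)))).
  rewrite {1 2}(divn_eq j 27); set h := (j %/ 27)%N.
  have := ltn_pmod j (isT : (0 < 27)%N); move: (j %% 27)%N => r r27.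
  rewrite 2!(exprD _ (h * 27) r) (mulnC h 27) (mulnC 13 h) !(exprM _ 27 h) (mulnC h 13)
    (exprM _ 13 h).
  have -> : u ^+ 27 * ((w ^+ 27) ^+ h * w ^+ r) * (w ^+ 13) ^+ h =
     ((w ^+ 27 * w ^+ 13) ^+ h) * (u ^+ 27 * w ^+ r) :> rat.
    rewrite [in RHS]exprMn; move: (u ^+ 27) ((w ^+ 27) ^+ h) ((w ^+ 13) ^+ h) (w ^+ r) =>
      t v y z; ring.
  apply: ler_pM; rewrite ?exprn_ge0 //; first by apply: expr_mono; rewrite ?exprn_ge0.
  rewrite -[leLHS]mulr1; apply: ler_pM; rewrite ?exprn_ge0 ?exprn_ege1 //.
  by rewrite ler_weXn2l // ltnW.
apply: ler_pM; rewrite ?mulr_ge0 ?exprn_ge0 //.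
  rewrite ler_wpM2l ?exprn_ge0 // exprM; apply: expr_mono => //.
  by rewrite wE -natrX ler_nat; nia.
apply: (@le_trans _ _ ((p%:R ^+ 2) ^+ (13 * (j %/ 27)))).
  by rewrite p3; apply: expr_mono => //; rewrite wE; lra.
rewrite p3 in vl *; apply: ler_weXn2l; [lra | exact: vl].
Qed.

Section Point.
Variable a : int.
Hypothesis ha : ~~ (p %| a)%Z.
Local Notation x := (point F a).

Lemma pnorm_a : pnorm a%:~R = 1.
Proof.
rewrite pnorm_int_abs pnorm_nat.
  have -> : logn p `|a| = 0%N; last by rewrite expr0 invr1.
  by apply/eqP; rewrite -leqn0 leqNgt logn_gt0 mem_primes p_pr /= negb_and orbC; move: ha => ->.
by rewrite absz_gt0; apply: contraNneq ha => ->; rewrite dvdz0.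
Qed.

Lemma pnorm_point : pnorm x = F%:R.
Proof. by rewrite /point pnormM pnormV pnorm_a pnorm_F invrK mul1r. Qed.

Lemma pnorm_pointD (z : int) : pnorm (x + z%:~R) = F%:R.
Proof.
rewrite pnorm_dom ?pnorm_point // (le_lt_trans (pnorm_int_le1 _ (intr_int _ z))) //.
by rewrite ltr1n; lia.
Qed.

Lemma pnorm_node_prod j : pnorm (node_prod j x) = F%:R ^+ (2 * j).
Proof.
rewrite /node_prod pnorm_prod (eq_bigr (fun=> F%:R ^+ 2)).
  by rewrite prodr_const card_ord -exprM.
move=> i _; rewrite pnormM expr2; congr (_ * _); last exact: (pnorm_pointD i).
by have := pnorm_pointD (- (1 + i%:Z)); rewrite rmorphN rmorphD /= opprD addrA.
Qed.

Lemma node_prod_neq0 j : node_prod j x != 0.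
Proof. by rewrite -(pnorm_eq0 p_pr) pnorm_node_prod expf_neq0 // gt_eqF. Qed.

Definition tends0 (u : nat -> rat) :=
  forall e, 0 < e -> exists N, forall n, (N <= n)%N -> pnorm (u n) <= e.

Lemma tends0D u v : tends0 u -> tends0 v -> tends0 (fun n => u n + v n).
Proof.
move=> hu hv e e0; have [N hN] := hu e e0; have [M hM] := hv e e0.
exists (maxn N M) => n; rewrite geq_max => /andP[Nn Mn].
by apply: pnorm_le_add; [exact: hN | exact: hM].
Qed.

Lemma tends0Z c u : tends0 u -> tends0 (fun n => c * u n).
Proof.
move=> hu e e0; have c0 : 0 < pnorm c + 1 by rewrite ltr_wpDl ?pnorm_ge0.
have [N hN] := hu (e / (pnorm c + 1)) (divr_gt0 e0 c0).
exists N => n /hN h; rewrite pnormM.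
apply: (@le_trans _ _ ((pnorm c + 1) * pnorm (u n))).
  by rewrite ler_wpM2r ?pnorm_ge0 // lerDl.
by rewrite mulrC -ler_pdivlMr.
Qed.

Lemma eq_tends0 u v : (forall n, u n = v n) -> tends0 u -> tends0 v.
Proof. by move=> uv hu e /hu[N hN]; exists N => n /hN; rewrite uv. Qed.

Lemma tends0_poly_geom C u :
  (forall n, pnorm (u n) * 2%:R ^+ n <= C * n.+1%:R ^+ 3) -> tends0 u.
Proof.
move=> hu e e0; have [N hN] := poly_geom_small C e0.
exists N => n /hN h; rewrite -(@ler_pM2r _ (2%:R ^+ n)) ?exprn_gt0 //.
exact: le_trans h.
Qed.

Lemma pnorm_rem_term n j : pnorm (rem_coef n j / node_prod j.+1 x) * F%:R ^+ (2 * j) <=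
   j.*2.+1%:R * pnorm j`!%:R ^+ 2.
Proof.
have -> : pnorm (rem_coef n j / node_prod j.+1 x) * F%:R ^+ (2 * j) =
  pnorm (rem_coef n j) / F%:R ^+ 2.
  have B0 : F%:R ^+ (2 * j) != 0 :> rat by rewrite expf_neq0 // gt_eqF.
  rewrite pnormM pnormV pnorm_node_prod mulnS exprD.
  by move: B0; move: (F%:R ^+ (2 * j)) => B B0; field; rewrite B0 gt_eqF.
apply: le_trans (pnorm_rem_coef p_pr n j).
by rewrite ler_piMr ?pnorm_ge0 // invf_le1 ?exprn_gt0 // exprn_ege1 // (le_trans _ F2) // ler1n.
Qed.

Lemma tends0_rem_coef n : tends0 (fun j => rem_coef n j / node_prod j x).
Proof.
apply: (@tends0_poly_geom 2) => j.
rewrite pnormM pnormV pnorm_node_prod.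
apply: (@le_trans _ _ (pnorm (rem_coef n j))).
  rewrite -mulrA ler_piMr ?pnorm_ge0 // mulrC ler_pdivrMr ?exprn_gt0 // mul1r.
  by apply: exp2_le_sqr; lia.
apply: (le_trans (pnorm_rem_coef p_pr n j)).
apply: (@le_trans _ _ j.*2.+1%:R).
  by rewrite ler_piMr // pnorm_fact_le1.
rewrite -natrX -natrM ler_nat; nia.
Qed.

(** The error satisfies the recurrence up to a term that tends to 0 in K, and it
    vanishes for n = 0. *)
Lemma tends0_rem_error n : tends0 (fun K => rem_error x K n).
Proof.
suff [] : tends0 (fun K => rem_error x K n) /\ tends0 (fun K => rem_error x K n.-1) by [].
elim: n => [|n [IH1 IH2]].
  have h : tends0 (fun K => rem_error x K 0).
    by move=> e e0; exists 0%N => K _; rewrite rem_error0 ?pnorm0 ?ltW //; exact: node_prod_neq0.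
  by split.
split; last exact: IH1.
have n0 : n.+1%:R ^+ 3 != 0 :> rat by rewrite expf_neq0 // pnatr_eq0.
pose c := n.*2.+1%:R * (n%:R ^+ 2 + n%:R + 1 + 2 * (x * (x - 1))).
apply: (@eq_tends0 (fun K => (n.+1%:R ^+ 3)^-1 * (c * rem_error x K n +
  (- n%:R ^+ 3 * rem_error x K n.-1 +
   - (2 * n.*2.+1%:R) * (rem_coef n K / node_prod K x))))).
  move=> K; apply: (mulfI n0); rewrite mulrA divff // mul1r.
  have := apery_op_rem_error node_prod_neq0 K n; rewrite /apery_op -/c => h.
  have -> : n.+1%:R ^+ 3 * rem_error x K n.+1 = (n.+1%:R ^+ 3 * rem_error x K n.+1 - c *
    rem_error x K n + n%:R ^+ 3 * rem_error x K n.-1)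
     + c * rem_error x K n - n%:R ^+ 3 * rem_error x K n.-1 by ring.
  by rewrite h; ring.
apply: tends0Z; apply: tends0D; first exact: tends0Z.
by apply: tends0D; apply: tends0Z => //; exact: tends0_rem_coef.
Qed.

(** For q = Theta, the number Q_n q - P_n is the limit of the truncated remainders. *)
Lemma remainder_bound q n B : tends0 (fun K => q - ifs_sum x K) -> 0 < B ->
  (forall j, (n <= j)%N -> pnorm (rem_coef n j / node_prod j.+1 x) <= B) ->
  pnorm (apery_den x n * q - apery_num x n) <= B.
Proof.
move=> hq B0 hB.
have [N hN] := tends0D (tends0Z (apery_den x n) hq) (tends0_rem_error n) B0.
have -> : apery_den x n * q - apery_num x n = (apery_den x n * (q - ifs_sum x N) +
  rem_error x N n) + rem_sum x N n.
  by rewrite /rem_error; ring.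
apply: pnorm_le_add; first exact: hN.
apply: pnorm_sum => [|i _]; first exact: ltW.
have [ni|in_] := leqP n i; first exact: hB.
by rewrite /rem_coef rem_ratio_eq0 // mulr0 mul0r pnorm0 ltW.
Qed.

End Point.

End Analysis.

(** * Irrationality from good rational approximations *)

Lemma le_of_eq (y z : rat) : y = z -> y <= z. Proof. by move=> ->. Qed.

Section Irrationality.
Context {p : nat} (p_pr : prime p) (k F : nat).
Hypotheses (hF : F = (p ^ k)%N) (F_gt2 : (2 < F)%N).
Variable a : int.
Hypothesis ha : ~~ (p %| a)%Z.
Local Notation pnorm := (pnorm p_pr).
Local Notation x := (point F a).

Let F0 : 0 < F%:R :> rat. Proof. by rewrite ltr0n; lia. Qed.
Let x0 := node_prod_neq0 p_pr hF F_gt2 ha.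

(** The bounds (2j+1) 25^(-j) decrease geometrically, so the first one, for j = n,
    dominates up to a factor 2. *)
Lemma remainder_geom q : tends0 p_pr (fun K => q - ifs_sum x K) ->
  exists2 C, 0 < C & forall n,
    pnorm (apery_den x n * q - apery_num x n) * 25%:R ^+ n <= C * n.+1%:R.
Proof.
move=> hq; have [C C0 hC] := pnorm_fact_geom p_pr hF F_gt2.
have [u uE] : exists u : rat, u = 25%:R := ex_intro _ _ (erefl _).
have u1 : 2%:R <= u by rewrite uE; lra.
have u0 : 0 < u by apply: lt_le_trans u1.
rewrite -uE in hC *.
have up n : 0 < u ^+ n by rewrite exprn_gt0.
exists (2 * C); first by rewrite mulr_gt0.
move=> n; rewrite -ler_pdivlMr //.
apply: (@remainder_bound _ p_pr k F hF F_gt2 a ha) => //.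
  by rewrite divr_gt0 ?mulr_gt0 ?ltr0n.
move=> j nj.
have H1 : pnorm (rem_coef n j / node_prod j.+1 x) * u ^+ j <= C * j.*2.+1%:R.
  have Fp : 0 < F%:R ^+ (2 * j) :> rat by rewrite exprn_gt0.
  rewrite -(@ler_pM2r _ (F%:R ^+ (2 * j))) // mulrAC.
  apply: (@le_trans _ _ (j.*2.+1%:R * pnorm j`!%:R ^+ 2 * u ^+ j)).
    by rewrite ler_pM2r // (pnorm_rem_term p_pr hF F_gt2 ha).
  by rewrite -mulrA [leRHS]mulrAC [leRHS]mulrC ler_wpM2l.
apply: (@le_trans _ _ (C * j.*2.+1%:R / u ^+ j)); first by rewrite ler_pdivlMr.
rewrite ler_pdivrMr // [leRHS]mulrAC ler_pdivlMr //.
have [d jE] : exists d, j = (n + d)%N by exists (j - n)%N; rewrite subnKC.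
have -> : 2 * C * n.+1%:R * u ^+ j = (C * u ^+ n) * (2 * n.+1%:R * u ^+ d).
  by rewrite jE exprD; ring.
rewrite mulrAC ler_pM2l ?mulr_gt0 // jE.
have ud : (d.+1)%:R <= u ^+ d.
  apply: (@le_trans _ _ (2%:R ^+ d)); first by rewrite -natrX ler_nat ltn_expl.
  by apply: expr_mono.
apply: (@le_trans _ _ (2 * n.+1%:R * d.+1%:R)); last by rewrite ler_wpM2l // mulr_ge0.
by rewrite -!natrM ler_nat; nia.
Qed.

(** A power of p: its two absolute values are inverse to each other. *)
Lemma ppart_den_pnorm n : (ppart_den p F n)%:R * pnorm (ppart_den p F n)%:R = 1.
Proof.
have e : (ppart_den p F n = p ^ (k * n + logn p n`!))%N by rewrite /ppart_den hF -expnM -expnD.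
rewrite e pnorm_nat ?expn_gt0 ?prime_gt0 // pfactorK // natrX divff //.
by rewrite expf_neq0 // pnatr_eq0 -lt0n prime_gt0.
Qed.

Lemma common_den_pnorm n : (common_den p F n)%:R * pnorm (common_den p F n)%:R <=
  (lcm_upto n)%:R ^+ 3.
Proof.
rewrite /common_den natrM pnormM !natrX !pnormX mulrACA -!exprMn ppart_den_pnorm expr1n mulr1.
apply: expr_mono; first by rewrite mulr_ge0 ?pnorm_ge0.
by rewrite ler_piMr // pnorm_nat_le1.
Qed.

(** The product formula for the integer obtained from Q_n q - P_n by clearing
    denominators: its archimedean size is controlled by [apery_op_growth], its p-adic
    size by [remainder_geom]. *)
Lemma lower_bound q : tends0 p_pr (fun K => q - ifs_sum x K) ->
  exists A C, [/\ 0 <= A, 0 < C & forall n, apery_den x n * q - apery_num x n != 0 ->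
    25%:R ^+ n <= C * n.+1%:R * growth A n * (lcm_upto n)%:R ^+ 3].
Proof.
move=> hq; have [C1 C10 hC1] := remainder_geom hq.
have [|A [C2 [A0 C20 hA]]] := @apery_op_growth x (fun n => apery_den x n * q - apery_num x n) (-2).
  move=> n; transitivity (apery_op x (apery_den x) n * q - apery_op x (apery_num x) n).
    by rewrite /apery_op; ring.
  by rewrite apery_op_den apery_op_num //; ring.
have [D [D0 DE]] : exists D : nat, (0 < D)%N /\ D%:R * q \is a Num.int.
  exists `|denq q|%N; rewrite absz_gt0 denq_eq0; split=> //.
  rewrite natr_absz ger0_norm ?ltW ?denq_gt0 // mulrC -[q in q * _]divq_num_den divfK ?intr_int //.
  by rewrite intr_eq0 denq_eq0.
have [u uE] : exists u : rat, u = 25%:R := ex_intro _ _ (erefl _).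
have u0 : 0 < u by rewrite uE ltr0n.
rewrite -uE in hC1 *.
exists A, (D%:R * C2 * C1); split=> //; first by rewrite !mulr_gt0 ?ltr0n.
move=> n nz; set L := apery_den x n * q - apery_num x n in nz *.
pose z := (common_den p F n)%:R * D%:R * L.
have zint : z \is a Num.int.
  have -> : z = ((common_den p F n)%:R * apery_den x n) * (D%:R * q)
    - D%:R * ((common_den p F n)%:R * apery_num x n).
    by rewrite /z /L; ring.
  rewrite rpredB //; first by rewrite rpredM ?(apery_den_int p_pr hF).
  by rewrite rpredM ?natr_int ?(apery_num_int p_pr hF).
have m0 : (0 < common_den p F n)%N.
  rewrite /common_den /ppart_den hF !(muln_gt0, expn_gt0) lcm_upto_gt0 prime_gt0 //=.
have z0 : z != 0 by rewrite !mulf_neq0 // pnatr_eq0 -lt0n.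
have := pnorm_int_ge p_pr zint z0.
rewrite /z 2!normrM 2!pnormM !normr_nat => h.
have un0 : 0 < u ^+ n by rewrite exprn_gt0.
rewrite -[leLHS]mul1r.
apply: (@le_trans _ _ (((common_den p F n)%:R * pnorm (common_den p F n)%:R)
  * (D%:R * pnorm D%:R) * `|L| * (pnorm L * u ^+ n))).
  apply: (@le_trans _ _ ((common_den p F n)%:R * D%:R * `|L| * (pnorm (common_den p F n)%:R *
    pnorm D%:R * pnorm L) * u ^+ n)).
    by rewrite ler_pM2r.
  by apply: le_of_eq; ring.
apply: (@le_trans _ _ ((lcm_upto n)%:R ^+ 3 * D%:R * (C2 * growth A n) * (C1 * n.+1%:R)));
  last by apply: le_of_eq; ring.
have pp y : 0 <= y%:R * pnorm y%:R by rewrite mulr_ge0 ?pnorm_ge0.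
have e1 : D%:R * pnorm D%:R <= D%:R by rewrite ler_piMr ?pnorm_nat_le1.
have e2 := ler_pM (pp _) (pp _) (common_den_pnorm n) e1.
have e3 := ler_pM (mulr_ge0 (pp _) (pp _)) (normr_ge0 _) e2 (hA n).
have h0 : 0 <= pnorm L * u ^+ n by rewrite mulr_ge0 ?pnorm_ge0 ?ltW.
exact: (ler_pM (mulr_ge0 (mulr_ge0 (pp _) (pp _)) (normr_ge0 _)) h0 e3 (hC1 n)).
Qed.

(** For each n the lower bound applies to n or to n+1, by [casoratian], and
    [lcm_upto_small] supplies infinitely many n that violate it.  The slack between
    (29/10)^3 = 24.389 and 25 absorbs the polynomial factors: with d = 1/250 their five
    factors (1+d)^n still leave (29/10)^3 (1+d)^5 < 25. *)
Lemma not_rational_limit q : ~ tends0 p_pr (fun K => q - ifs_sum x K).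
Proof.
move=> hq; have [A [C [A0 C0 hC]]] := lower_bound hq.
have [u uE] : exists u : rat, u = 25%:R := ex_intro _ _ (erefl _).
have [c cE] : exists c : rat, c = 29%:R / 10%:R := ex_intro _ _ (erefl _).
have [d dE] : exists d : rat, d = 1 / 250%:R := ex_intro _ _ (erefl _).
have u1 : 1 <= u by rewrite uE; lra.
have c1 : 1 < c by rewrite cE; lra.
have c8 : 8%:R < c ^+ 2 by rewrite cE; lra.
have d0 : 0 < d by rewrite dE; lra.
have cdu : c ^+ 3 * (1 + d) ^+ 5 < u by rewrite cE dE uE; lra.
rewrite -uE in hC.
have [K1 K10 hK1] := growth_subexp ler01 d0.
have [K2 K20 hK2] := growth_subexp A0 d0.
have cd0 : 0 < c ^+ 3 * (1 + d) ^+ 5.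
  by apply: mulr_gt0; apply: exprn_gt0; [exact: lt_trans c1 | exact: addr_gt0].
have small := fun N => lcm_upto_small N c1 c8.
have [v vE] : exists v, v = c ^+ 3 * (1 + d) ^+ 5 := ex_intro _ _ (erefl _).
rewrite -vE in cdu cd0.
clear uE cE dE c8.
(* a bound free of the nonvanishing condition, losing only a polynomial factor *)
have key n : u ^+ n <= (C * 2 * (1 + A)) * n.+1%:R ^+ 4 * growth A n * (lcm_upto n)%:R ^+ 3.
  have [nz|] := boolP (apery_den x n * q - apery_num x n != 0).
    apply: (le_trans (hC _ nz)).
    apply: ler_wpM2r; first by rewrite exprn_ge0.
    apply: ler_wpM2r; first by rewrite (le_trans ler01) ?growth_ge1.
    rewrite -(mulrA C) -(mulrA C) ler_pM2l //.
    have A1 : 1 <= 2 * (1 + A) by lra.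
    apply: (@le_trans _ _ (n.+1%:R ^+ 4)).
      by rewrite -[leLHS]expr1 ler_weXn2l // ler1n.
    by rewrite ler_peMl // exprn_ge0.
  rewrite negbK => /eqP e0.
  have nz : apery_den x n.+1 * q - apery_num x n.+1 != 0.
    apply/eqP => e1; have := casoratian x0 n.
    have -> : apery_num x n.+1 = apery_den x n.+1 * q by apply/eqP; rewrite eq_sym -subr_eq0 e1.
    have -> : apery_num x n = apery_den x n * q by apply/eqP; rewrite eq_sym -subr_eq0 e0.
    rewrite [X in X - _]mulrAC [X in _ - X]mulrAC [X in _ - X * q]mulrC subrr => /esym/eqP.
    by rewrite mulf_eq0 invr_eq0 expf_eq0 /= pnatr_eq0.
  apply: (@le_trans _ _ (u ^+ n.+1)); first by rewrite ler_weXn2l.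
  apply: (le_trans (hC _ nz)).
  have dS : (lcm_upto n.+1)%:R <= (lcm_upto n)%:R * n.+1%:R :> rat.
    rewrite -natrM ler_nat lcm_uptoS; apply: dvdn_leq; first by rewrite muln_gt0 lcm_upto_gt0.
    by rewrite dvdn_lcm dvdn_mulr ?dvdn_mull.
  apply: (@le_trans _ _ (C * n.+2%:R * growth A n.+1 * ((lcm_upto n)%:R * n.+1%:R) ^+ 3)).
    apply: ler_wpM2l; last exact: expr_mono.
    by rewrite !mulr_ge0 ?(ltW C0) // (le_trans ler01) ?growth_ge1.
  have pS : growth A n.+1 <= growth A n * (1 + A).
    rewrite growthS ler_wpM2l ?(le_trans ler01) ?growth_ge1 // lerD2l.
    by rewrite ler_pdivrMr ?ltr0n // ler_peMr // ler1n.
  apply: (@le_trans _ _ (C * (2 * n.+1%:R) * (growth A n * (1 +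
    A)) * ((lcm_upto n)%:R * n.+1%:R) ^+ 3)).
    apply: ler_wpM2r; first by rewrite exprn_ge0 ?mulr_ge0.
    have e1 : C * n.+2%:R <= C * (2 * n.+1%:R).
      rewrite (ler_pM2l C0) -[n.+2%:R]natr1.
      have : 1 <= n.+1%:R :> rat by rewrite ler1n.
      by lra.
    apply: ler_pM e1 pS; first by rewrite mulr_ge0 ?(ltW C0).
    by rewrite (le_trans ler01) ?growth_ge1.
  by apply: le_of_eq; ring.
pose B := C * 2 * (1 + A) * K1 ^+ 4 * K2.
have b1 : 1 < u / v by rewrite ltr_pdivlMr // mul1r.
have [N hN] := exists_expr_gt B b1.
have [n Nn dn] := small N.
have : B < (u / v) ^+ n.
  by apply: (lt_le_trans hN); rewrite ler_weXn2l // ltW.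
rewrite expr_div_n ltr_pdivlMr ?exprn_gt0 // ltNge => /negP; apply.
apply: (le_trans (key n)).
have d1 : 0 <= 1 + d by rewrite addr_ge0 ?(ltW d0).
have c0 : 0 <= c by rewrite (le_trans ler01) ?ltW.
apply: (@le_trans _ _ (C * 2 * (1 + A) * (K1 * (1 + d) ^+ n) ^+ 4 * (K2 * (1 +
  d) ^+ n) * (c ^+ n) ^+ 3)).
  have CA : 0 <= C * 2 * (1 + A) by rewrite !mulr_ge0 ?(ltW C0) ?addr_ge0.
  have n0 : 0 <= n.+1%:R :> rat by exact: ler0n.
  have n4 : 0 <= n.+1%:R ^+ 4 :> rat by exact: exprn_ge0.
  have p0 : 0 <= growth A n by rewrite (le_trans ler01) ?growth_ge1.
  have D0 : 0 <= (lcm_upto n)%:R :> rat by exact: ler0n.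
  have D3 : 0 <= (lcm_upto n)%:R ^+ 3 :> rat by exact: exprn_ge0.
  have h1 := hK1 n; rewrite growth1 in h1.
  have e1 := ler_wpM2l CA (expr_mono 4 n0 h1).
  have e2 := ler_pM (mulr_ge0 CA n4) p0 e1 (hK2 n).
  exact: (ler_pM (mulr_ge0 (mulr_ge0 CA n4) p0) D3 e2 (expr_mono 3 D0 dn)).
apply: le_of_eq; rewrite /B.
have -> : v ^+ n = (c ^+ n) ^+ 3 * ((1 + d) ^+ n) ^+ 5.
  by rewrite vE exprMn -!exprM ![(_ * n)%N]mulnC.
by ring.
Qed.

End Irrationality.

(** * The Hurwitz series as an inverse factorial series *)

Lemma sum_bin_bernoulli n :
  \sum_(i < n) 'C(n, i)%:R * bernoulli i = (n == 1%N)%:R.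
Proof.
have := bernoulliP n; rewrite /ps_mul big_ord_recr /= subnn eqxx mulr0 addr0 => h.
transitivity (n`!%:R * (n == 1%N)%:R : rat); last first.
  by case: n h => [|[|n]] _; rewrite ?mulr0 ?mul1r.
rewrite -h mulr_sumr; apply: eq_bigr => i _.
have in_ := ltn_ord i; rewrite subn_eq0 leqNgt in_ /=.
rewrite -(bin_fact (ltnW in_)) !natrM; field.
by rewrite !fact_neq0.
Qed.

(** Both sides satisfy the same triangular recurrence. *)
Lemma bernoulli_diffE K j : (j < K.*2)%N ->
  (-1) ^+ j * j.+1%:R * bernoulli j = bernoulli_diff K j.
Proof.
elim/ltn_ind: j => j IH jK.
have h1 := @bernoulli_diff_rec K j.+1 jK.
have h2 : \sum_(i < j.+1) 'C(j.+2, i.+1)%:R * (-1) ^+ i * ((-1) ^+ i * i.+1%:R * bernoulli i)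
    = 2 *+ (j.+1 == 1%N).
  transitivity (j.+2%:R * \sum_(i < j.+1) 'C(j.+1, i)%:R * bernoulli i).
    rewrite mulr_sumr; apply: eq_bigr => i _.
    rewrite [RHS]mulrA -natrM (mul_bin_diag j.+2 i) natrM.
    have sg : (-1) ^+ i * (-1) ^+ i = 1 :> rat by rewrite -expr2 sqrr_sign.
    transitivity (((-1) ^+ i * (-1) ^+ i) * (i.+1%:R * 'C(j.+2, i.+1)%:R * bernoulli i));
      first by ring.
    by rewrite sg mul1r.
  by rewrite sum_bin_bernoulli; case: (j) => [|m]; rewrite ?mulr0 ?mulr1.
move: h1; rewrite -h2 !big_ord_recr /=.
rewrite (eq_bigr (fun i : 'I_j => 'C(j.+2, i.+1)%:R * (-1) ^+ i * ((-1)
  ^+ i * i.+1%:R * bernoulli i))); last first.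
  by move=> i _; rewrite IH // (ltn_trans (ltn_ord i)).
move/addrI/mulfI => -> //.
by rewrite mulf_neq0 ?signr_eq0 // pnatr_eq0 -lt0n bin_gt0.
Qed.

(** A truncated geometric series in t/x, without its first term 1/x; the differences of
    [hurwitz_sum_ifs] annihilate the constant 1/x. *)
Lemma sum_geometric_kernel (x t : rat) J : x != 0 -> x - t != 0 ->
  \sum_(j < J) t ^+ j.+1 / x ^+ j.+2 =
  (x - t)^-1 - x^-1 - (t / x) ^+ J.+1 / (x - t).
Proof.
move=> x0 xt0; elim: J => [|J IH].
  by rewrite big_ord0; field; rewrite x0 xt0.
rewrite big_ord_recr /= IH !expr_div_n !exprS; field.
by rewrite x0 xt0 expf_neq0.
Qed.

Lemma prod_sym_nodes x k :
  \prod_(i < k.*2.+2) (- x - k%:R + i%:R) = node_prod k.+1 x :> rat.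
Proof.
rewrite -doubleS -addnn big_split_ord /= (reindex_inj rev_ord_inj) /= /node_prod -big_split /=.
apply: eq_bigr => i _; have ik : (i <= k)%N by rewrite -ltnS.
by rewrite subSS natrB // natrD -[k.+1%:R]natr1; ring.
Qed.

(** The divided difference of 1/(x-t) at the nodes -k, ..., k+1. *)
Lemma altsum_kernel x k : (forall i, node_prod i x != 0) ->
  - altsum k.*2.+1 (fun i => (x - (i%:R - k%:R))^-1) = k.*2.+1`!%:R / node_prod k.+1 x.
Proof.
move=> x0; rewrite -prod_sym_nodes -altsum_partial_fraction.
  rewrite -[RHS]mul1r -[1]opprK mulNr mulN1r opprK; congr (- _).
  rewrite -[LHS]opprK; congr (- _); rewrite -[LHS]mulN1r -altsumZ; apply: eq_altsum => i.
  by rewrite mulN1r -invrN; congr (_^-1); ring.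
move=> i ik; have := x0 k.+1; rewrite -prod_sym_nodes => /prodf_neq0 h.
exact: (h (Ordinal (ik : (i < k.*2.+2)%N)) isT).
Qed.

(** Partial sums of the Bernoulli series of Theta. *)
Definition hurwitz_sum (x : rat) (J : nat) : rat :=
  \sum_(j < J) (-1) ^+ j * j.+1%:R * bernoulli j / x ^+ j.+2.

(** Replacing the Bernoulli numbers by differences of powers and summing the geometric
    series first, one finds the differences of 1/(x-t), which give the inverse factorial
    series, and an explicit error from the tail of the geometric series. *)
Lemma hurwitz_sum_ifs x J : x != 0 -> (forall i, node_prod i x != 0) ->
  (forall i k : nat, x - (i%:R - k%:R) != 0) ->
  hurwitz_sum x J - ifs_sum x J = \sum_(k < J) diff_weight k *
    altsum k.*2.+1 (fun i => ((i%:R - k%:R) / x) ^+ J.+1 / (x - (i%:R - k%:R))).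
Proof.
move=> x0 g0 xik.
have -> : hurwitz_sum x J = \sum_(k < J) diff_weight k *
    - altsum k.*2.+1 (fun i => \sum_(j < J) (i%:R - k%:R) ^+ j.+1 / x ^+ j.+2).
  rewrite /hurwitz_sum.
  transitivity (\sum_(j < J) \sum_(k < J) diff_weight k *
      - altsum k.*2.+1 (fun i => (i%:R - k%:R) ^+ j.+1) / x ^+ j.+2).
    apply: eq_bigr => j _; rewrite (@bernoulli_diffE J); last by have := ltn_ord j; lia.
    by rewrite /bernoulli_diff mulr_suml.
  rewrite exchange_big; apply: eq_bigr => k _ /=.
  rewrite (altsum_sum _ _ (fun j i => (i%:R - k%:R) ^+ j.+1 / x ^+ j.+2)) -sumrN mulr_sumr.
  apply: eq_bigr => j _; rewrite -mulrA mulNr; congr (_ * - _).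
  by rewrite mulrC -altsumZ; apply: eq_altsum => i; rewrite mulrC.
rewrite /ifs_sum -sumrB; apply: eq_bigr => k _.
rewrite (eq_altsum (fun i => (x - (i%:R - k%:R))^-1 - x^-1 * 1 -
    ((i%:R - k%:R) / x) ^+ J.+1 / (x - (i%:R - k%:R)))); last first.
  by move=> i; rewrite sum_geometric_kernel // mulr1.
rewrite altsumB altsumB altsumZ altsum1 mulr0 subr0 opprB altsum_kernel //.
rewrite mulrDr -addrA -[RHS]addr0; congr (_ + _); apply/eqP; rewrite subr_eq0; apply/eqP.
rewrite /diff_weight /ifs_term; field.
by rewrite fact_neq0 g0 nat1r pnatr_eq0.
Qed.

Section Limit.
Context {p : nat} (p_pr : prime p).
Local Notation Zp := (padic_int p_pr).
Local Notation Qp := (padic p_pr).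
Local Notation pnorm := (pnorm p_pr).

Lemma limn_padic (u : nat -> Qp) (l : Qp) :
  (forall e : rat, 0 < e -> exists N, forall n, (N <= n)%N -> padic_norm (u n - l) <= e) ->
  limn u = l.
Proof.
move=> h; apply: cvg_lim; first exact: metric_hausdorff.
apply/cvg_ballP => e e0; have e2 : 0 < e / 2 by rewrite divr_gt0.
have [N hN] := h _ e2; exists N => // n /= /hN le.
rewrite ballEmdist /= (_ : mdist l (u n) = padic_norm (u n - l)).
  by rewrite (le_lt_trans le) // ltr_pdivrMr // ltr_pMr // ltr1n.
by rewrite -[RHS]padic_normN opprB.
Qed.

Lemma pexp_small (e : rat) : 0 < e -> exists n, p%:R ^- n <= e.
Proof.
move=> e0; have [|n hn] := @exists_expr_gt p%:R e^-1; first by rewrite ltr1n prime_gt1.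
exists n; rewrite -[e]invrK lef_pV2 ?posrE ?invr_gt0 ?expp_rat_gt0 //.
exact: ltW.
Qed.

(** The natural numbers are dense among the rationals that are p-adic integers: invert
    the prime-to-p part of the denominator modulo p^n. *)
Lemma approx_nat (q : rat) n : pnorm q <= 1 -> exists b : nat, pnorm (q - b%:R) <= p%:R ^- n.
Proof.
move=> q1; have d0 : (0 < `|denq q|)%N by rewrite absz_gt0 denq_eq0.
have [m cpm dE] := pfactor_coprime p_pr d0.
set v := logn p _ in dE.
have m0 : (0 < m)%N by move: d0; rewrite dE muln_gt0 => /andP[].
have qE : q = (numq q)%:~R / (m%:R * p%:R ^+ v).
  have : denq q = (m * p ^ v)%N :> int by rewrite -dE gez0_abs ?denq_ge0.
  by move=> dz; rewrite -[LHS]divq_num_den dz -pmulrn natrM natrX.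
have pv0 : p%:R ^+ v != 0 :> rat by rewrite gt_eqF ?expp_rat_gt0.
have mn0 : m%:R != 0 :> rat by rewrite pnatr_eq0 -lt0n.
have pm : pnorm m%:R = 1.
  rewrite pnorm_nat // (_ : logn p m = 0%N) ?expr0 ?invr1 //.
  by apply/eqP; rewrite -leqn0 leqNgt logn_gt0 mem_primes p_pr m0 /= -prime_coprime.
have ppv : pnorm (p%:R ^+ v) = p%:R ^- v.
  by rewrite -[in LHS]natrX pnorm_nat ?expn_gt0 ?prime_gt0 // pfactorK.
have /dvdnP[z zE] : (p ^ v %| `|numq q|)%N.
  rewrite -(pnorm_nat_le p_pr) -pnorm_int_abs.
  have -> : (numq q)%:~R = q * (m%:R * p%:R ^+ v) by rewrite {2}qE divfK ?mulf_neq0.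
  by rewrite !pnormM pm mul1r ppv ler_piMl // invr_ge0 ltW ?expp_rat_gt0.
have [a _ pam] := Bezoutl m (@expp_gt0 p p_pr n).
rewrite (eqP (coprimeXl n cpm)) in pam.
 pose sg : int := (-1) ^+ (numq q < 0)%R.
pose y : int := - (sg * z%:Z * a%:Z).
have ppn : pnorm (p ^ n)%:R = p%:R ^- n by rewrite pnorm_nat ?expn_gt0 ?prime_gt0 // pfactorK.
exists `|(y %% (p ^ n)%N%:Z)%Z|%N.
have -> : q - `|(y %% (p ^ n)%N%:Z)%Z|%N%:R =
   (sg * z%:Z)%:~R * (1 + a * m)%N%:R / m%:R + (y %/ (p ^ n)%N%:Z)%Z%:~R * (p ^ n)%:R.
  have -> : `|(y %% (p ^ n)%N%:Z)%Z|%N%:R = y%:~R - (y %/ (p ^ n)%N%:Z)%Z%:~R * (p ^ n)%:R :> rat.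
    rewrite natr_absz ger0_norm ?modz_ge0 ?eqz_nat -?lt0n ?expp_gt0 //.
    by rewrite /modz rmorphB rmorphM.
  have -> : q = (sg * z%:Z)%:~R / m%:R.
    rewrite {1}qE [numq q]intEsign -/sg zE PoszM !rmorphM /= -!pmulrn natrX; field.
    by rewrite mn0 pv0.
  rewrite /y rmorphN !rmorphM /= -!pmulrn natrD natrM; field.
  by [].
apply: pnorm_le_add.
  rewrite 2!pnormM pnormV pm invr1 mulr1 -[leRHS]mul1r.
  apply: ler_pM; rewrite ?pnorm_ge0 ?pnorm_int_le1 ?intr_int //.
  by rewrite pnorm_nat_le.
rewrite pnormM ppn ler_piMl ?pnorm_int_le1 ?intr_int //.
Qed.

Lemma eqmod_pnorm (b c n : nat) : pnorm (b%:R - c%:R) <= p%:R ^- n -> b = c %[mod p ^ n].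
Proof.
wlog bc : b c / (c <= b)%N => [th|].
  case: (leqP c b) => [|/ltnW] h; first exact: th.
  by move=> H; apply/esym/th => //; rewrite -pnormN opprB.
by rewrite -natrB // pnorm_nat_le => H; apply/eqP; rewrite eqn_mod_dvd.
Qed.

(** Completeness of Q_p, for sequences of rationals: after subtraction of a constant the
    sequence consists of p-adic integers, and natural approximations of it modulo
    p^n form a coherent family of residues. *)
Lemma padic_complete (u : nat -> rat) :
  (forall e, 0 < e -> exists N, forall n, (N <= n)%N -> pnorm (u n - u N) <= e) ->
  exists l : Qp, forall e : rat, 0 < e ->
    exists N, forall n, (N <= n)%N -> padic_norm (ratr (u n) - l) <= e.
Proof.
move=> hu.
have pe n : 0 < p%:R ^- n :> rat by rewrite invr_gt0 expp_rat_gt0.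
have /choice [N hN] : forall n, exists N, forall m, (N <= m)%N -> pnorm (u m - u N) <= p%:R ^- n.
  by move=> n; exact: hu.
pose v m := u m - u (N 0%N).
pose M n := maxn (N 0%N) (N n).
have v1 m : (N 0%N <= m)%N -> pnorm (v m) <= 1.
  by move=> /hN; rewrite expr0 invr1.
have vM n m : (M n <= m)%N -> pnorm (v m - v (M n)) <= p%:R ^- n.
  rewrite geq_max => /andP[_ nm].
  have -> : v m - v (M n) = (u m - u (N n)) - (u (M n) - u (N n)) by rewrite /v; ring.
  by apply: pnorm_le_add; rewrite ?pnormN hN // leq_maxr.
have /choice [b hb] : forall n, exists b : nat, pnorm (v (M n) - b%:R) <= p%:R ^- n.
  by move=> n; apply: approx_nat; apply: v1; exact: leq_maxl.
have vb n m : (M n <= m)%N -> pnorm (v m - (b n)%:R) <= p%:R ^- n.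
  move=> nm; have -> : v m - (b n)%:R = (v m - v (M n)) + (v (M n) - (b n)%:R) by ring.
  by apply: pnorm_le_add; [exact: vM | exact: hb].
have coh n : b n = b n.+1 %[mod p ^ n].
  apply: eqmod_pnorm; pose m := maxn (M n) (M n.+1).
  have -> : (b n)%:R - (b n.+1)%:R = (v m - (b n.+1)%:R) - (v m - (b n)%:R) :> rat by ring.
  apply: pnorm_le_add; last by rewrite pnormN vb // leq_maxl.
  apply: le_trans (vb n.+1 m (leq_maxr _ _)) _.
  by rewrite lef_pV2 ?posrE ?expp_rat_gt0 // ler_weXn2l // ler1n prime_gt0.
pose z : Zp := padic_int_of coh.
have bz n : zp_norm ((b n)%:R - z) <= p%:R ^- n.
  rewrite zp_norm_le residueD residueN residue_nat /= modnDmr.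
  by rewrite addnC subnK ?modnn // ltnW // ltn_mod expp_gt0.
exists (z%:F + ratr (u (N 0%N))) => e /pexp_small[n ne]; exists (M n) => m nm.
apply: le_trans ne.
have -> : ratr (u m) - (z%:F + ratr (u (N 0%N))) = ratr (v m - (b n)%:R) + ((b n)%:R - z)%:F.
  rewrite !padic_ratrD !padic_ratrN ratr_nat tofracD tofracN rmorph_nat; ring.
apply: le_trans (padic_normD _ _) _; rewrite ge_max padic_norm_tofrac bz andbT.
exact: vb.
Qed.

End Limit.

(** * The Hurwitz value *)

Section Theta.
Context {p : nat} (p_pr : prime p) (k F : nat).
Hypotheses (hF : F = (p ^ k)%N) (F_gt2 : (2 < F)%N).
Variable a : int.
Hypothesis ha : ~~ (p %| a)%Z.
Local Notation pnorm := (pnorm p_pr).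
Local Notation x := (point F a).

Let F0 : 0 < F%:R :> rat. Proof. by rewrite ltr0n; lia. Qed.
Let x0 := node_prod_neq0 p_pr hF F_gt2 ha.

Lemma pnorm_diff_weight j : pnorm (diff_weight j) <= (j.+1 * j.*2.+1)%:R.
Proof.
have -> : diff_weight j = (-1) ^+ j * (((j`! * j`!)%:R / (j + j).+1`!%:R) * j.+1%:R^-1).
  rewrite /diff_weight addnn natrM; field.
  by rewrite fact_neq0 nat1r pnatr_eq0.
rewrite 2!pnormM pnorm_sign mul1r [leRHS]natrM [leRHS]mulrC.
apply: ler_pM; [exact: pnorm_ge0 | exact: pnorm_ge0 | | by rewrite pnorm_invn /=].
by have := pnorm_beta p_pr j j; rewrite addnn.
Qed.

Lemma point_neq0 : x != 0.
Proof. by rewrite -(pnorm_eq0 p_pr) (pnorm_point p_pr hF ha) gt_eqF. Qed.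

Lemma pnorm_point_sub (i j : nat) : pnorm (x - (i%:R - j%:R)) = F%:R.
Proof.
by have := pnorm_pointD p_pr hF F_gt2 ha (- (i%:Z - j%:Z)); rewrite rmorphN rmorphB.
Qed.

(** The error terms of [hurwitz_sum_ifs] have absolute value at most a polynomial in J
    times F^(-J), since the nodes are integers while |x| = F. *)
Lemma tends0_hurwitz_ifs : tends0 p_pr (fun J => hurwitz_sum x J - ifs_sum x J).
Proof.
apply: (@tends0_poly_geom _ _ 2) => J.
rewrite hurwitz_sum_ifs ?point_neq0 //; last first.
  by move=> i j; rewrite -(pnorm_eq0 p_pr) pnorm_point_sub gt_eqF.
have FJ : 0 < F%:R ^+ J :> rat by rewrite exprn_gt0.
have B0 : 0 <= 2 * J.+1%:R ^+ 2 / F%:R ^+ J :> rat.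
  by rewrite divr_ge0 ?mulr_ge0 ?exprn_ge0 // ltW.
suff H : pnorm (\sum_(j < J) diff_weight j * altsum j.*2.+1
    (fun i => ((i%:R - j%:R) / x) ^+ J.+1 / (x - (i%:R - j%:R)))) <= 2 * J.+1%:R ^+ 2 / F%:R ^+ J.
  apply: (@le_trans _ _ (2 * J.+1%:R ^+ 2 / F%:R ^+ J * F%:R ^+ J)).
    by apply: ler_pM; rewrite ?pnorm_ge0 ?exprn_ge0 // expr_mono // ler_nat ltnW.
  rewrite divfK ?gt_eqF // [in leRHS]exprS ler_wpM2l //.
  by rewrite ler_peMl ?exprn_ge0 // ler1n.
apply: pnorm_sum => // j _; rewrite pnormM.
apply: ler_pM; rewrite ?pnorm_ge0 //.
  apply: le_trans (pnorm_diff_weight j) _; rewrite -natrX -natrM ler_nat.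
  by have := ltn_ord j; nia.
apply: pnorm_altsum => [|i _]; first by rewrite invr_ge0 ltW.
rewrite pnormM pnormV pnorm_point_sub pnormX pnormM pnormV (pnorm_point p_pr hF ha).
have t1 : pnorm (i%:R - j%:R) <= 1.
  by rewrite pnorm_int_le1 // rpredB ?natr_int.
have F1 : F%:R^-1 <= 1 :> rat by rewrite invf_le1 // ler1n; lia.
have Fi : 0 <= F%:R^-1 :> rat by rewrite invr_ge0 ltW.
have e0 : 0 <= pnorm (i%:R - j%:R) * F%:R^-1 by rewrite mulr_ge0 ?pnorm_ge0.
have e1 : pnorm (i%:R - j%:R) * F%:R^-1 <= F%:R^-1 by rewrite ler_piMl.
apply: le_trans (ler_wpM2r Fi (expr_mono J.+1 e0 e1)) _.
rewrite exprS -exprVn [F%:R^-1 * _]mulrC -mulrA.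
by rewrite ler_piMr ?exprn_ge0 // mulr_ile1.
Qed.

Lemma tends0_ifs_term : tends0 p_pr (ifs_term x).
Proof.
apply: (@tends0_poly_geom _ _ 1) => j; rewrite mul1r.
have Fj : 0 < F%:R ^+ (2 * j.+1) :> rat by rewrite exprn_gt0.
have -> : ifs_term x j = (-1) ^+ j * (j`!%:R ^+ 2 * (j.+1%:R^-1 / node_prod j.+1 x)).
  by rewrite /ifs_term; field; rewrite x0 nat1r pnatr_eq0.
rewrite pnormM pnorm_sign mul1r pnormM pnormX pnormM [pnorm (node_prod _ _)^-1]pnormV
  (pnorm_node_prod p_pr hF F_gt2 ha).
apply: (@le_trans _ _ (1 * (j.+1%:R / F%:R ^+ (2 * j.+1)) * F%:R ^+ (2 * j.+1))).
  have e0 : pnorm j.+1%:R^-1 <= j.+1%:R by rewrite pnorm_invn /=.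
  have Gi : 0 <= (F%:R ^+ (2 * j.+1))^-1 :> rat by rewrite invr_ge0 ltW.
  have e1 := ler_wpM2r Gi e0.
  have A0 : 0 <= pnorm j`!%:R ^+ 2 by rewrite exprn_ge0 ?pnorm_ge0.
  have e2 := ler_pM A0 (mulr_ge0 (pnorm_ge0 _ _) Gi) (pnorm_fact_le1 p_pr j) e1.
  have e3 : 2%:R ^+ j <= F%:R ^+ (2 * j.+1) :> rat.
    apply: (@le_trans _ _ (2%:R ^+ j.+1)); first by rewrite ler_weXn2l // ler1n.
    by apply: exp2_le_sqr; lia.
  apply: ler_pM e2 e3; last exact: exprn_ge0.
  exact: (mulr_ge0 A0 (mulr_ge0 (pnorm_ge0 _ _) Gi)).
by rewrite mul1r divfK ?gt_eqF // -[leLHS]expr1 ler_weXn2l // ler1n.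
Qed.

Lemma ifs_sum_cauchy e : 0 < e ->
  exists N, forall n, (N <= n)%N -> pnorm (ifs_sum x n - ifs_sum x N) <= e.
Proof.
move=> e0; have [N hN] := tends0_ifs_term e0; exists N => n /subnKC <-.
rewrite /ifs_sum big_split_ord /= addrAC subrr add0r.
by apply: pnorm_sum => [|i _]; [exact: ltW | apply: hN; exact: leq_addr].
Qed.

Lemma hurwitz_sum_cauchy e : 0 < e ->
  exists N, forall n, (N <= n)%N -> pnorm (hurwitz_sum x n - hurwitz_sum x N) <= e.
Proof.
move=> e0; have [N hN] := ifs_sum_cauchy e0; have [M hM] := tends0_hurwitz_ifs e0.
exists (maxn N M) => n; rewrite geq_max => /andP[Nn Mn].
have -> : hurwitz_sum x n - hurwitz_sum x (maxn N M) = (hurwitz_sum x n - ifs_sum x n) -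
    (hurwitz_sum x (maxn N M) - ifs_sum x (maxn N M)) +
      ((ifs_sum x n - ifs_sum x N) - (ifs_sum x (maxn N M) - ifs_sum x N)).
  by ring.
by do 2?[apply: pnorm_le_add]; rewrite ?pnormN ?hM ?hN ?leq_maxl ?leq_maxr.
Qed.

Lemma hurwitz_limit_irrational : exists l : padic p_pr,
  (forall e : rat, 0 < e -> exists N, forall n, (N <= n)%N ->
     padic_norm (ratr (hurwitz_sum x n) - l) <= e) /\ ~ exists q : rat, l = ratr q.
Proof.
have [l hl] := padic_complete hurwitz_sum_cauchy; exists l; split=> // -[q lq].
apply: (not_rational_limit hF F_gt2 ha (q := q)) => e e0.
have [N hN] := hl e e0; have [M hM] := tends0_hurwitz_ifs e0.
exists (maxn N M) => n; rewrite geq_max => /andP[Nn Mn].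
have -> : q - ifs_sum x n = (hurwitz_sum x n - ifs_sum x n) - (hurwitz_sum x n - q) by ring.
apply: pnorm_le_add; first exact: hM.
by rewrite pnormN /pnorm padic_ratrD padic_ratrN -lq hN.
Qed.

End Theta.

Lemma padic_ratrX {p : nat} (p_pr : prime p) (q : rat) n :
  ratr (q ^+ n) = ratr q ^+ n :> padic p_pr.
Proof. by elim: n => [|n IH]; rewrite ?padic_ratr1 // !exprS padic_ratrM IH. Qed.

Section Power.
Context {p : nat} {p_pr : prime p}.
Local Notation Qp := (padic p_pr).

Lemma padic_binom_m2 j : padic_binom (-2) j = (-1) ^+ j * j.+1%:R :> Qp.
Proof.
rewrite /padic_binom; have -> : \prod_(i < j) (- 2 - i%:R) = (-1) ^+ j * (j.+1)`!%:R :> Qp.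
  elim: j => [|j IH]; first by rewrite big_ord0 mul1r.
  by rewrite big_ord_recr /= IH [j.+2`!]factS natrM exprS -!natr1; ring.
by rewrite factS natrM mulrA mulfK // padic_natr_eq0 -lt0n fact_gt0.
Qed.

Lemma padic_norm1 : padic_norm (1 : Qp) = 1.
Proof. by rewrite -tofrac1 padic_norm_tofrac zp_norm1. Qed.

Lemma padic_normX (u : Qp) n : padic_norm (u ^+ n) = padic_norm u ^+ n.
Proof. by elim: n => [|n IH]; rewrite ?padic_norm1 // !exprS padic_normM IH. Qed.

Lemma padic_normV (u : Qp) : padic_norm u^-1 = (padic_norm u)^-1.
Proof.
have [->|u0] := eqVneq u 0; first by rewrite invr0 padic_norm0 invr0.
apply: (mulfI (_ : padic_norm u != 0)); first by rewrite padic_norm_eq0.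
by rewrite -padic_normM !divff ?padic_norm_eq0 // padic_norm1.
Qed.

Lemma padic_norm_nat_le1 n : padic_norm (n%:R : Qp) <= 1.
Proof. by have := pnorm_nat_le1 p_pr n; rewrite /pnorm ratr_nat. Qed.

(** The binomial series of u^(-2) is the derivative of a geometric series: its partial
    sums are explicit, with an error of absolute value at most |u-1|^n. *)
Lemma padic_pow_m2 (u : Qp) : padic_norm (u - 1) <= p%:R^-1 -> padic_norm u = 1 ->
  padic_pow u (-2) = u ^- 2.
Proof.
move=> u1 nu; apply: limn_padic => e /(pexp_small p_pr)[N hN].
have u0 : u != 0 by rewrite -padic_norm_eq0 nu oner_eq0.
exists N => n Nn; rewrite /series /= big_mkord.
have -> : \sum_(i < n) padic_binom (-2) i * (u - 1) ^+ i =
   u ^- 2 * (1 - (-1) ^+ n * (u - 1) ^+ n * (n.+1%:R + n%:R * (u - 1))).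
  apply: (mulfI (expf_neq0 2 u0)); rewrite mulrA divff ?expf_neq0 // mul1r.
  elim: n {Nn} => [|n IH]; first by rewrite big_ord0 mul0r addr0 !mul1r subrr mulr0.
  rewrite big_ord_recr /= mulrDr IH padic_binom_m2 !exprS -!natr1; ring.
have -> : u ^- 2 * (1 - (-1) ^+ n * (u - 1) ^+ n * (n.+1%:R + n%:R * (u - 1))) - u ^- 2 =
   - (u ^- 2 * ((-1) ^+ n * (u - 1) ^+ n * (n.+1%:R + n%:R * (u - 1)))) by ring.
rewrite padic_normN 3!padic_normM padic_normV 3!padic_normX nu padic_normN padic_norm1.
rewrite !expr1n invr1 !mul1r.
have un : padic_norm (u - 1) ^+ n <= p%:R ^- N.
  apply: (@le_trans _ _ (p%:R^-1 ^+ n)); first by apply: expr_mono; rewrite ?padic_norm_ge0.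
  rewrite exprVn lef_pV2 ?posrE ?expp_rat_gt0 // ler_weXn2l // ler1n prime_gt0 //.
apply: le_trans hN; rewrite -[leRHS]mulr1; apply: ler_pM; rewrite ?exprn_ge0 ?padic_norm_ge0 //.
apply: le_trans (padic_normD _ _) _; rewrite ge_max padic_norm_nat_le1 /= padic_normM.
rewrite mulr_ile1 ?padic_norm_ge0 ?padic_norm_nat_le1 //.
by apply: le_trans u1 _; rewrite invf_le1 ?ltr0n ?ler1n prime_gt0.
Qed.

Lemma zp_normX (z : padic_int p_pr) n : zp_norm (z ^+ n) = zp_norm z ^+ n.
Proof. by elim: n => [|n IH]; rewrite ?zp_norm1 // !exprS zp_normM IH. Qed.

Lemma zp_norm_le1 (z : padic_int p_pr) : zp_norm z <= 1.
Proof.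
have := zp_norm_le z 0; rewrite expr0 invr1 => ->.
by have := residue_lt z 0; rewrite expn0 ltnS leqn0.
Qed.

Lemma zp_sign_exprz (z : int) : exists b : bool, (-1) ^ z = (-1) ^+ b :> padic_int p_pr.
Proof.
case: (intP z) => [|n|n]; first by exists false.
  by exists (odd n.+1); rewrite signr_odd.
exists (odd n.+1); rewrite -exprnN -[in LHS]signr_odd.
by case: (odd n.+1); rewrite ?expr0 ?invr1 // expr1 invrN1.
Qed.

(** The Teichmuller character takes units as values and is the identity modulo p; for
    p = 2 this only needs a and the sign to be odd. *)
Lemma teichmuller_norm (a : int) : ~~ (p %| a)%Z ->
  zp_norm (teichmuller a : padic_int p_pr) = 1 /\
  zp_norm (a%:~R - teichmuller a : padic_int p_pr) <= p%:R^-1.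
Proof.
move=> pa; have [p2|p2] := eqVneq p 2%N.
  have [b tE] : exists b : bool, teichmuller a = (-1) ^+ b :> padic_int p_pr.
    by rewrite /teichmuller (negbTE pa) (introT eqP p2); exact: zp_sign_exprz.
  rewrite tE zp_normX zp_normN zp_norm1 expr1n; split=> //.
  have -> : a%:~R - (-1) ^+ b = (a - (-1) ^+ b)%:~R :> padic_int p_pr.
    by rewrite rmorphB rmorphXn rmorphN1.
  have -> : p%:R^-1 = p%:R ^- 1 :> rat by rewrite expr1.
  rewrite zp_norm_le residue_int_eq0.
  move: pa; rewrite p2; case: b {tE} => /=; rewrite ?expr0 ?expr1; lia.
have [t1 [z zE]] := teichmullerP (p_pr := p_pr) p2 pa.
have p1 := prime_gt1 p_pr.
split.
  have /eqP := congr1 (@zp_norm p p_pr) t1.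
  by rewrite zp_normX zp_norm1 pexpr_eq1 ?zp_norm_ge0 ?subn_gt0 // => /eqP.
rewrite -zp_normN opprB zE zp_normM -[leRHS]mulr1.
apply: ler_pM; rewrite ?zp_norm_ge0 ?zp_norm_le1 //.
have -> : p%:R^-1 = p%:R ^- 1 :> rat by rewrite expr1.
by rewrite zp_norm_le residue_nat expn1 modnn.
Qed.

End Power.

Lemma quotient_sub1 (R : fieldType) (w b : R) : w != 0 -> w^-1 * b - 1 = w^-1 * (b - w).
Proof. by move=> w0; rewrite mulrBr mulVf. Qed.

(** The final rearrangement, over an abstract field, where computation is cheap. *)
Lemma solve_hurwitz (R : fieldType) (w b f l r : R) :
  w != 0 -> b != 0 -> f != 0 -> 2 != 0 :> R ->
  w ^- 2 * ((f * 2)^-1 * (w ^+ 2 / b ^+ 2) * ((b / f) ^+ 2 * l)) = r ->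
  l = 2 * f ^+ 3 * r.
Proof. by move=> w0 b0 f0 t0 <-; field; rewrite w0 b0 f0 t0. Qed.

Theorem corollary11p3 (p : nat) (p_pr : prime p) (k F : nat)
  (hF : F = (p ^ k)%N) (F_gt2 : (2 < F)%N) (a : int) (ha : ~~ (p %| a)%Z) :
  ~ exists q : rat,
      (@teichmuller p p_pr a)%:F ^- 2 * padic_hurwitz (3%:R : padic_int p_pr) a F
      = ratr q.
Proof.
have [l [hl irr]] := hurwitz_limit_irrational p_pr hF F_gt2 ha.
have [w1 aw] := teichmuller_norm (p_pr := p_pr) ha.
set w := (teichmuller a)%:F.
have nw : padic_norm w = 1 by rewrite padic_norm_tofrac.
have w0 : w != 0 by rewrite -padic_norm_eq0 nw oner_eq0.
have na : padic_norm (a%:~R : padic p_pr) = 1.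
  by have := pnorm_a p_pr ha; rewrite /pnorm ratr_int.
have a0 : a%:~R != 0 :> padic p_pr by rewrite -padic_norm_eq0 na oner_eq0.
have F0 : F%:R != 0 :> padic p_pr by rewrite padic_natr_eq0; lia.
have two0 : 2 != 0 :> padic p_pr by rewrite padic_natr_eq0.
have s2 : 1 - (3%:R : padic_int p_pr)%:F = -2 :> padic p_pr by rewrite rmorph_nat; ring.
have pw : padic_pow (teichmuller_angle p_pr a) (-2) = w ^+ 2 / a%:~R ^+ 2.
  rewrite padic_pow_m2 /teichmuller_angle -/w.
  - by rewrite exprMn exprVn invfM invrK.
  - rewrite (quotient_sub1 _ w0) padic_normM padic_normV nw invr1 mul1r.
    have -> : a%:~R - w = (a%:~R - teichmuller a : padic_int p_pr)%:F.
      by rewrite tofracB rmorph_int.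
    by rewrite padic_norm_tofrac.
  - by rewrite padic_normM padic_normV nw na invr1 mulr1.
have x0 := point_neq0 p_pr hF F_gt2 ha.
have xE : ratr (point F a) = a%:~R / F%:R :> padic p_pr.
  by rewrite /point padic_ratrM padic_ratrV ratr_int ratr_nat.
have sumE n : \sum_(j < n) padic_binom (-2) j * ratr (bernoulli j) * (F%:R / a%:~R) ^+ j
    = ratr (point F a ^+ 2) * ratr (hurwitz_sum (point F a) n) :> padic p_pr.
  rewrite -padic_ratrM /hurwitz_sum mulr_sumr.
  rewrite (big_morph (fun q : rat => ratr q : padic p_pr) (padic_ratrD p_pr) (padic_ratr0 p_pr)).
  apply: eq_bigr => j _; rewrite padic_binom_m2.
  have -> : point F a ^+ 2 * ((-1) ^+ j * j.+1%:R * bernoulli j / point F a ^+ j.+2) =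
     ((-1) ^+ j * j.+1%:R) * bernoulli j * (point F a)^-1 ^+ j.
    by rewrite exprVn !exprS; field; rewrite x0 expf_neq0.
  rewrite (padic_ratrM p_pr ((-1) ^+ j * j.+1%:R * bernoulli j)) (padic_ratrM p_pr ((-1)
    ^+ j * j.+1%:R)).
  rewrite (padic_ratrM p_pr ((-1) ^+ j)) (padic_ratrX p_pr (-1)) (padic_ratrX p_pr (point F a)^-1).
  rewrite padic_ratrN padic_ratr1 padic_ratrV xE ratr_nat.
  by rewrite invf_div.
have lim : limn [series padic_binom (-2) j * ratr (bernoulli j) * (F%:R / a%:~R) ^+ j]_j
   = ratr (point F a ^+ 2) * l.
  apply: limn_padic => e e0.
  have nx0 : 0 < pnorm p_pr (point F a ^+ 2) by rewrite pnorm_gt0 expf_neq0.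
  have [N hN] := hl _ (divr_gt0 e0 nx0); exists N => n Nn.
  rewrite seriesEord -[X in padic_norm (X - _)]/(\sum_(j < n) padic_binom (-2)
    j * ratr (bernoulli j) * (F%:R / a%:~R) ^+ j) sumE.
  rewrite -mulrBr padic_normM -ler_pdivlMl // mulrC.
  exact: hN.
case=> q; rewrite /padic_hurwitz s2 pw lim.
have -> : (3%:R : padic_int p_pr)%:F - 1 = 2 :> padic p_pr.
  by rewrite -[LHS]opprB s2 opprK.
rewrite padic_ratrX xE => /solve_hurwitz hq; apply: irr; exists (2 * F%:R ^+ 3 * q).
rewrite 2!padic_ratrM padic_ratrX !ratr_nat.
exact: (hq w0 a0 F0 two0).
Qed.
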